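(* Let $\sigma,p>0$, let $R_0=[y_{\min},y_{\max}]\times[\theta_{\min},\theta_{\max}]$ with $y_{\min}>0$ and $\theta_{\min}>0$, let $\mu_0$ be a Borel probability measure on $\Omega=\mathbb{R}_+\times\mathbb{R}_+$ with $\operatorname{supp}\mu_0\subset R_0$, let $\mu=(\mu_t)_{t\ge 0}$ be the measure-valued solution to $$\partial_t\mu+\partial_y(u(\mu)\mu)=0$$ with initial data $\mu_0$, and let $\pi$ be its (time-independent) $\theta$-marginal. Then there exists a strictly increasing function $g\in C^\infty([\theta_{\min},\theta_{\max}])$ such that $$\sup_{\theta\in\operatorname{supp}\pi}\mathcal{W}_1(\mu_t^\theta,\delta_{g(\theta)})\le C e^{-ct},\qquad t>0,$$ where $C,c>0$ depend only on $\mu_0$ and the parameters of the model. Moreover, under the assumption $$\sigma\theta_{\min}>\frac{p+1}{p}\quad\text{or}\quad\frac{\theta_{\max}}{\theta_{\min}}<p+1,$$ the map $\pi\mapsto g$ is Lipschitz: there is a constant $C$, independent of $\pi$ and $\tilde\pi$, such that if $g$ and $\tilde g$ are the functions associated with two solutions whose initial data are supported in $R_0$ and have $\theta$-marginals $\pi$ and $\tilde\pi$ respectively, then $$\sup_{\theta\in[\theta_{\min},\theta_{\max}]}|g(\theta)-\tilde g(\theta)|\le C\,\mathcal{W}_1(\pi,\tilde\pi).$$ In particular $g$ is unique for each $\pi$. Here the function $g$ associated with a solution is, on all of $[\theta_{\min},\theta_{\max}]$, the long-time limit of the characteristics, $g(\theta)=\lim_{t\to\infty}Y(t,y,\theta)$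 for $y\in[y_{\min},y_{\max}]$.
   Context: $\mathbb{R}_+=(0,\infty)$, $\Omega=\mathbb{R}_+\times\mathbb{R}_+$ with points $(y,\theta)$. $\mathcal{P}_0(\Omega)$ is the set of Borel probability measures on $\Omega$ with compact support contained in $\Omega$. The velocity is $u(\mu)=\partial_y(W*\mu+\sigma V)$ with $W(y)=-\tfrac12y^2$, $V(y,\theta)=\tfrac12\theta y^2-\tfrac1{p+2}y^{p+2}$; explicitly $$u(\mu_t)(y,\theta)=\int_\Omega (z-y)\,d\mu_t(z,\eta)+\sigma(\theta-y^p)y .$$ A measure-valued solution on $[0,T)$ with initial data $\mu_0$ is a weakly* continuous map $t\mapsto\mu_t\in\mathcal{P}_0(\Omega)$ such that for all $\varphi\in C_0^\infty([0,T)\times\Omega)$ and $0<t<T$, $$\int_\Omega\varphi(t,y,\theta)\,d\mu_t=\int_\Omega\varphi(0,y,\theta)\,d\mu_0+\int_0^t\int_\Omega[\partial_s\varphi+u(\mu_s)\,\partial_y\varphi]\,d\mu_s\,ds .$$ For $\mu_0$ supported in $R_0$, ''the'' measure-valued solution is the global one ($T$ arbitrary) whose supports stay bounded and bounded away from $\partial\Omega$ uniformly in time; it is the push-forward $\mu_t=(Y(t,\cdot,\cdot),\theta)_\#\mu_0$ along the characteristics $$\frac{d}{dt}Y(t,y,\theta)=\int_\Omega\big(Y(t,y',\theta')-Y(t,y,\theta)\big)\,d\mu_0(y',\theta')+\sigma\,Y(t,y,\theta)\big(\theta-Y(t,y,\theta)^p\big),\quad Y(0,y,\theta)=y .$$ The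 $\theta$-marginal $\pi$ is $d\pi(\theta)=\int_{y\in\mathbb{R}_+}d\mu_t(y,\theta)$; it does not depend on $t$. By disintegration $\mu_t=\mu_t^\theta\otimes d\pi(\theta)$, i.e. $\int_\Omega\varphi\,d\mu_t=\int_{\mathbb{R}_+}\int_{\mathbb{R}_+}\varphi(y,\theta)\,d\mu_t^\theta(y)\,d\pi(\theta)$, where $\mu_t^\theta$ are probability measures on $\mathbb{R}_+$. One fixes a disintegration $\{\mu_0^\theta\}_{\theta\in\operatorname{supp}\pi}$ of $\mu_0$ with each $\mu_0^\theta$ supported in $[y_{\min},y_{\max}]$ and takes $\mu_t^\theta=Y(t,\cdot,\theta)_\#\mu_0^\theta$. $\mathcal{W}_1$ is the Wasserstein-1 distance, $\mathcal{W}_1(\mu,\nu)=\sup\{|\int\varphi\,d\mu-\int\varphi\,d\nu|:\ \mathrm{Lip}(\varphi)\le1\}$. $\delta_a$ is the Dirac mass at $a$. The parameters of the model are $\sigma,p$. *)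

(* Defs.v *)
From mathcomp Require Import all_boot all_order all_algebra.
From mathcomp Require Import all_classical all_reals all_analysis.
From mathcomp Require Import measurable_realfun.
Set Implicit Arguments.
Unset Strict Implicit.
Unset Printing Implicit Defensive.
Import Order.TTheory GRing.Theory Num.Theory.
Import numFieldNormedType.Exports.
Local Open Scope classical_set_scope.
Local Open Scope ring_scope.

(* The topological support of a (Borel) measure. *)
Definition msupport (T : topologicalType) (R : realType)
    (m : set T -> \bar R) : set T :=
  [set x | forall U, open U -> U x -> (0 < m U)%E].

(* Kantorovich form of the Wasserstein-1 distance.  All the measures to which
   it is applied have bounded support, so the two integrals are finite. *)
Definition W1 (R : realType) (m n : set R -> \bar R) : \bar R :=
  ereal_sup [set `| \int[m]_x (phi x)%:E - \int[n]_x (phi x)%:E |%E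
            | phi in [set phi : R -> R | 1.-lipschitz (phi : R^o -> R^o)]].

(* Class C^oo: all the iterated directional derivatives are (Frechet)
   differentiable at every point. *)
Definition smooth (R : realType) (V : normedModType R) (f : V -> R) :=
  forall (s : seq V) (x : V),
    differentiable (foldr (fun v (h : V -> R^o) => 'D_v h) f s) x.

(* C^oo on a (closed) set: restriction of a C^oo function on the line. *)
Definition smooth_on (R : realType) (A : set R) (f : R -> R) :=
  exists F : R -> R, smooth (F : R^o -> R) /\ {in A, F =1 f}.

(* Points are pairs (y, theta). *)
Definition Omega (R : realType) : set (R * R) := [set q | 0 < q.1 /\ 0 < q.2].

(* A measure on Omega with compact support contained in Omega is represented
   by the measure on the plane that extends it by zero. *)
Definition P0 (R : realType) (m : probability (R * R)%type R) :=
  compact (msupport m) /\ msupport m `<=` @Omega R.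

(* C_0(Omega), the predual of the finite measures on Omega.  Functions are
   extended by zero outside of Omega, which preserves continuity. *)
Definition C0_Omega (R : realType) (psi : R * R -> R) :=
  continuous psi /\
  forall e : R, 0 < e -> exists K, [/\ compact K, K `<=` @Omega R &
    forall q, ~ K q -> `|psi q| < e].

(* Test functions on [0, T) x Omega, of the variable (t, (y, theta)): they are
   the restrictions to t >= 0 of the smooth functions on the whole space with
   compact support in ]-oo, T[ x Omega. *)
Definition test_function (R : realType) (T : R) (phi : R * (R * R) -> R) :=
  smooth phi /\
  exists K, [/\ compact K, K `<=` [set x | x.1 < T /\ Omega x.2] &
    forall x, ~ K x -> phi x = 0].

Definition velocity (R : realType) (sigma p : R)
    (m : probability (R * R)%type R) (q : R * R) : R :=
  \int[m]_(z in @Omega R) (z.1 - q.1) + sigma * (q.2 - q.1 `^ p) * q.1.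

Record measure_valued_solution (R : realType) (sigma p T : R)
    (mu0 : probability (R * R)%type R)
    (mu : R -> probability (R * R)%type R) : Prop := {
  mvs_P0 : forall t : R, 0 <= t < T -> P0 (mu t);
  mvs_weak_star_continuous : forall psi, C0_Omega psi ->
    {within `[0, T[, continuous (fun t => \int[mu t]_(q in @Omega R) psi q)};
  mvs_weak : forall phi, test_function T phi -> forall t : R, 0 < t < T ->
    \int[mu t]_(q in @Omega R) phi (t, q) =
    \int[mu0]_(q in @Omega R) phi (0, q) +
    \int[lebesgue_measure]_(s in `[0, t])
      \int[mu s]_(q in @Omega R)
        ('D_(1, (0, 0)) (phi : _ -> R^o) (s, q) +
         velocity sigma p (mu s) q * 'D_(0, (1, 0)) (phi : _ -> R^o) (s, q)) }.

(* [Y t y theta] is only meaningful for t >= 0 and (y, theta) in Omega.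
   The differential equation is imposed for t > 0, together with continuity
   up to t = 0. *)
Record characteristics (R : realType) (sigma p : R)
    (mu0 : probability (R * R)%type R) (Y : R -> R -> R -> R) : Prop := {
  char_gt0 : forall t y th : R, 0 <= t -> Omega (y, th) -> 0 < Y t y th;
  char_measurable : forall t : R, 0 <= t ->
    measurable_fun [set: R * R] (fun q => Y t q.1 q.2);
  char_integrable : forall t : R, 0 <= t ->
    mu0.-integrable (@Omega R) (fun q => (Y t q.1 q.2)%:E);
  char_init : forall y th : R, Omega (y, th) -> Y 0 y th = y;
  char_continuous : forall y th : R, Omega (y, th) ->
    {within `[0, +oo[, continuous (fun t => Y t y th)};
  char_ode : forall t y th : R, 0 < t -> Omega (y, th) ->
    is_derive (t : R^o) (1 : R^o) (fun s => Y s y th : R^o)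
      (\int[mu0]_(q in @Omega R) (Y t q.1 q.2 - Y t y th) +
       sigma * Y t y th * (th - Y t y th `^ p)) }.

(* [mu] is the global measure-valued solution with initial data [mu0] and [Y]
   is the flow of its characteristics. *)
Record solution (R : realType) (sigma p : R) (mu0 : probability (R * R)%type R)
    (mu : R -> probability (R * R)%type R) (Y : R -> R -> R -> R) : Prop := {
  sol_mvs : forall T : R, 0 < T -> measure_valued_solution sigma p T mu0 mu;
  sol_uniform_support : exists K, [/\ compact K, K `<=` @Omega R &
    forall t : R, 0 <= t -> msupport (mu t) `<=` K];
  sol_characteristics : characteristics sigma p mu0 Y;
  sol_pushforward : forall (t : R) A, 0 <= t -> measurable A ->
    mu t A = pushforward mu0 (fun q => (Y t q.1 q.2, q.2)) A }.

Definition theta_marginal (R : realType) (m : probability (R * R)%type R) :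
    set R -> \bar R :=
  pushforward m snd.

Definition disintegration (R : realType) (m : probability (R * R)%type R)
    (pi : set R -> \bar R) (k : R -> probability R R) :=
  forall f : R * R -> \bar R, measurable_fun [set: R * R] f ->
    (forall q, 0 <= f q)%E ->
    measurable_fun (msupport pi) (fun th => \int[k th]_y f (y, th))%E /\
    (\int[m]_q f q = \int[pi]_(th in msupport pi) \int[k th]_y f (y, th))%E.

(* [nu t theta] is the conditional measure mu_t^theta: the disintegration of
   [mu 0] is any one with fibres supported in [ymin, ymax], and it is
   transported by the characteristics. *)
Record conditional_measures (R : realType) (ymin ymax : R)
    (pi : set R -> \bar R) (mu : R -> probability (R * R)%type R)
    (Y : R -> R -> R -> R) (nu : R -> R -> probability R R) : Prop := {
  cond_disintegration : forall t : R, 0 <= t -> disintegration (mu t) pi (nu t);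
  cond_support0 : forall th : R, msupport pi th ->
    msupport (nu 0 th) `<=` `[ymin, ymax];
  cond_pushforward : forall (t th : R) A, 0 <= t -> msupport pi th -> measurable A ->
    nu t th A = pushforward (nu 0 th) (fun y => Y t y th) A }.

Definition long_time_limit (R : realType) (ymin ymax thmin thmax : R)
    (Y : R -> R -> R -> R) (g : R -> R) :=
  forall y th : R, ymin <= y <= ymax -> thmin <= th <= thmax ->
    Y t y th @[t --> +oo] --> g th.

(* Main.v *)
(* In the variable X = ln Y the characteristics solve
     X' = M(t) e^(-X) - 1 + sigma (theta - e^(p X)),   M = mean of e^X.
   If X - X~ <= S everywhere then M <= e^S M~, so the nonlocal term never
   increases sup (X - X~), while the superlinear damping e^(p X) contracts it.
   Comparing the flow with constants gives uniform bounds; comparing it with its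
   own time shifts, and two points with the same theta, gives exponential
   convergence.  The limit G = ln g solves e^(m - G) - 1 + sigma (theta - e^(p G))
   = 0 with e^m the limit of M; the left-hand side decreases strictly in G, so
   that G is the smooth inverse of a function of one variable.
   The same competition makes g, as a function of the mean e^m, grow at most like
   a power k < 1 of e^m.  Two profiles with means e^m >= e^m' then satisfy
   e^m - int g dpi~ >= e^m - e^(k (m - m')) e^m', which bounds m - m' by
   W1(pi, pi~). *)

Require Import Defs.
From mathcomp Require Import all_boot all_order all_algebra.
From mathcomp Require Import all_classical all_reals all_analysis.
From mathcomp Require Import measurable_realfun ring lra.
Set Implicit Arguments.
Unset Strict Implicit.
Unset Printing Implicit Defensive.
Import Order.TTheory GRing.Theory Num.Theory.
Import numFieldNormedType.Exports.
Local Open Scope classical_set_scope.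
Local Open Scope ring_scope.

(** * Comparison principle *)

(** The supremum over a continuum of characteristics need not be differentiable in time, so no
    differential inequality is written for it. The supremum is taken over the indices and over
    [0, T] at once, and relaxation at some finite rate [A], however large, is enough. This needs
    bounds on [0, T] before any comparison: crude ones, depending on T, come from each equation
    separately, and the comparison then improves them to constant barriers [alpha] and [beta]. The
    lower barrier fixes the decay rate: sigma p e^(p alpha) is the least slope of the damping sigma
    e^(p X) above [alpha]. In the stationary problem the nonlocal term has slope at most A = e^(beta
    - alpha) and the damping at least B = sigma p e^(p alpha), whence the power k = A / (A + B).
    These numbers involve only sigma, p and the rectangle, so the constants are uniform over all
    data supported there. *)

Lemma within_continuousM (R : realType) (A : set R) (f g : R -> R) :
  {within A, continuous f} -> {within A, continuous g} ->
  {within A, continuous (fun x => f x * g x)}.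
Proof. by move=> cf cg x; apply: cvgM; [exact: cf|exact: cg]. Qed.

Lemma nonincreasing_endpoints (R : realType) (f df : R -> R) (a b : R) :
  a <= b -> {within `[a, b], continuous f} ->
  (forall x, a < x < b -> is_derive x 1 f (df x)) ->
  (forall x, a < x < b -> df x <= 0) -> f b <= f a.
Proof.
move=> + cf dfE df0; rewrite le_eqVlt => /predU1P[-> //|ab].
have dfE' x : x \in `]a, b[ -> is_derive x 1 f (df x).
  by rewrite in_itv; exact: dfE.
have [c] := MVT ab dfE' cf.
rewrite in_itv /= => /df0 dfc0 fba.
by rewrite -subr_le0 fba mulr_le0_ge0// subr_ge0 ltW.
Qed.

(* Put [K] for the supremum of [expR (c * t) * w i t].  Every such function relaxes
   towards [K] at rate [A], so that on [0, T] it stays below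
   [K - expR (- (A * T)) * (K - S0)]; taking the supremum yields [K <= S0].
   The constant [A] does not enter the conclusion. *)
Lemma sup_gronwall (R : realType) (I : Type) (D : set I) (w dw : I -> R -> R)
    (T c S0 B A : R) :
  0 <= c -> 0 <= S0 -> S0 <= B -> 0 <= A ->
  (forall i, D i -> {within `[0, T], continuous (w i)}) ->
  (forall i t, D i -> 0 < t < T -> is_derive t 1 (w i) (dw i t)) ->
  (forall i t, D i -> 0 <= t <= T -> w i t <= B) ->
  (forall i, D i -> w i 0 <= S0) ->
  (forall i t S, D i -> 0 < t < T -> 0 <= S <= expR (c * T) * B ->
    (forall j, D j -> w j t <= S) -> dw i t <= A * (S - w i t) - c * w i t) ->
  forall i t, D i -> 0 <= t <= T -> w i t <= S0 * expR (- (c * t)).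
Proof.
move=> c0 S00 S0B A0 cw dwE wB w0 dwle i0 t0 Di0 t0T.
have T0 : 0 <= T by case/andP: t0T => /le_trans; apply.
pose v i t := expR (c * t) * w i t.
(* Including [S0] makes the set nonempty and gives [S0 <= K] at once. *)
pose E := [set x | x = S0 \/ exists i t, [/\ D i, 0 <= t <= T & x = v i t]].
have ubB : ubound E (expR (c * T) * B).
  move=> x [->|[i [t [Di tT ->]]]].
    rewrite -[S0]mul1r ler_pM//; first by rewrite -expR0 ler_expR mulr_ge0.
  case/andP: (tT) => t0' tT'.
  apply: (@le_trans _ _ (expR (c * t) * B)).
    by rewrite ler_pM2l ?expR_gt0// wB.
  rewrite ler_wpM2r ?(le_trans S00)//.
  by rewrite ler_expR ler_wpM2l.
have supE : has_sup E by split; [exists S0; left | exists (expR (c * T) * B)].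
pose K := sup E.
have S0K : S0 <= K by apply: sup_upper_bound => //; left.
have vK i t : D i -> 0 <= t <= T -> v i t <= K.
  by move=> Di tT; apply: sup_upper_bound => //; right; exists i, t.
have KB : K <= expR (c * T) * B by apply: ge_sup => //; exact: supE.1.
have key i t : D i -> 0 <= t <= T -> v i t <= K - expR (- (A * T)) * (K - S0).
  move=> Di /andP[t_ge0 tT].
  (* Integrating factor for v' <= A (K - v). *)
  pose f s := expR (A * s) * (v i s - K).
  have : f t <= f 0.
    apply: (@nonincreasing_endpoints R f
      (fun s => expR (A * s) * (A * (v i s - K) +
        expR (c * s) * (c * w i s + dw i s)))) => //.
    - have cexp k : {within `[0, t], continuous (fun s => expR (k * s))}.
        apply: continuous_subspaceT => x.
        exact: (continuous_comp (@mulrl_continuous _ k x) (@continuous_expR _ _)).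
      apply: (@within_continuousM _ _ _ (fun s => v i s - K)) => //.
      apply: (@within_continuousB _ _ _ _ (v i)); last first.
        by move=> x; exact: cst_continuous.
      apply: (@within_continuousM _ _ _ (w i)) => //.
      apply: (continuous_subspaceW _ (cw i Di)) => y /=.
      by rewrite !in_itv/= => /andP[-> yt]; rewrite (le_trans yt).
    - move=> x /andP[x0 xt].
      have dwx : is_derive x 1 (w i) (dw i x).
        by apply: dwE => //; rewrite x0 (lt_le_trans xt).
      have ? : is_derive x 1 (fun s => expR (A * s)) (expR (A * x) * A).
        apply: (@is_derive1_comp R expR (fun s => A * s)).
        by apply: is_derive_eq; rewrite scaler1.
      have ? : is_derive x 1 (fun s => expR (c * s)) (expR (c * x) * c).
        apply: (@is_derive1_comp R expR (fun s => c * s)).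
        by apply: is_derive_eq; rewrite scaler1.
      rewrite /f /v; apply: is_derive_eq.
      rewrite /GRing.scale/=; ring.
    - move=> x /andP[x0 xt]; rewrite pmulr_rle0 ?expR_gt0//.
      have xT : 0 <= x <= T by rewrite ltW//= (le_trans _ tT)// ltW.
      (* [K] dominates every weighted function, so [S] dominates every [w j] at time [x] and is an
         admissible bound in the differential inequality. *)
      set S := K * expR (- (c * x)).
      have KS : K = expR (c * x) * S by rewrite /S mulrCA -expRD subrr expR0 mulr1.
      have dwx : dw i x <= A * (S - w i x) - c * w i x.
        apply: dwle => //.
        + by rewrite x0 (lt_le_trans xt).
        + rewrite mulr_ge0 ?expR_ge0 ?(le_trans S00)//=.
          apply: le_trans KB; rewrite -[leRHS]mulr1 ler_wpM2l ?(le_trans S00)//.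
          by rewrite -expR0 ler_expR oppr_le0 mulr_ge0// ltW.
        + move=> j Dj; rewrite -(ler_pM2l (expR_gt0 (c * x))) -KS.
          exact: vK.
      have := expR_gt0 (c * x); rewrite /v KS.
      move: (expR _) dwx => e dwx e0.
      have : e * (dw i x - (A * (S - w i x) - c * w i x)) <= 0.
        by rewrite pmulr_rle0// subr_le0.
      lra.
  rewrite /f mulr0 expR0 mul1r => ft.
  have v0 : v i 0 <= S0 by rewrite /v mulr0 expR0 mul1r w0.
  have : v i t - K <= expR (- (A * t)) * (S0 - K).
    rewrite -(ler_pM2l (expR_gt0 (A * t))) mulrA -expRD subrr expR0 mul1r.
    by apply: (le_trans ft); rewrite lerB.
  have : expR (- (A * T)) <= expR (- (A * t)) by rewrite ler_expR lerN2 ler_wpM2l.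
  move: (expR (- (A * T))) (expR (- (A * t))) => e1 e2 e12.
  have : e1 * (K - S0) <= e2 * (K - S0) by rewrite ler_wpM2r// subr_ge0.
  lra.
have : K <= K - expR (- (A * T)) * (K - S0).
  apply: ge_sup; first exact: supE.1.
  move=> x [->|[i [t [Di tT ->]]]]; last exact: key.
  rewrite lerBrDl -lerBrDr -[leRHS]mul1r ler_wpM2r ?subr_ge0//.
  by rewrite -expR0 ler_expR oppr_le0 mulr_ge0.
rewrite lerBrDl gerDr pmulr_rle0 ?expR_gt0// subr_le0 => KS0.
rewrite -(ler_pM2l (expR_gt0 (c * t0))) mulrCA -expRD subrr expR0 mulr1.
exact: le_trans (vK _ _ Di0 t0T) KS0.
Qed.

Lemma expR_sub1_le (R : realType) (x : R) : expR x - 1 <= x * expR x.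
Proof.
have : expR x * (1 - x) <= expR x * expR (- x).
  by rewrite ler_pM2l ?expR_gt0// expR_ge1Dx.
rewrite -expRD subrr expR0; lra.
Qed.

(** With w = X - X' <= S, the bound M <= e^S M' makes the nonlocal terms differ by at most M'
    e^(-X') (e^(S - w) - 1), which is of order S - w. By convexity e^(p X) lies above its tangent at
    X', so the damping contributes at most - sigma p e^(p X') w. Only X' therefore enters the rate
    [c]. This is the inequality that [sup_gronwall] asks for. *)
Lemma comparison (R : realType) (I : Type) (D : set I) (th : I -> R)
    (sigma p : R) (X X' dX dX' : I -> R -> R) (M M' : R -> R) (T c S0 B m : R) :
  0 <= sigma -> 0 <= p -> 0 <= c -> 0 <= S0 ->
  (forall i, D i -> {within `[0, T], continuous (X i)}) ->
  (forall i, D i -> {within `[0, T], continuous (X' i)}) ->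
  (forall i t, D i -> 0 < t < T -> is_derive t 1 (X i) (dX i t)) ->
  (forall i t, D i -> 0 < t < T -> is_derive t 1 (X' i) (dX' i t)) ->
  (forall i t, D i -> 0 < t < T ->
    dX i t <= M t * expR (- X i t) - 1 + sigma * (th i - expR (p * X i t))) ->
  (forall i t, D i -> 0 < t < T ->
    M' t * expR (- X' i t) - 1 + sigma * (th i - expR (p * X' i t)) <= dX' i t) ->
  (forall i t, D i -> 0 <= t <= T -> `|X i t| <= B /\ `|X' i t| <= B) ->
  (forall t, 0 < t < T -> 0 <= M' t <= m) ->
  (forall t S, 0 < t < T -> 0 <= S -> (forall j, D j -> X j t - X' j t <= S) ->
    M t <= expR S * M' t) ->
  (forall i t, D i -> 0 < t < T -> c <= sigma * p * expR (p * X' i t)) ->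
  (forall i, D i -> X i 0 - X' i 0 <= S0) ->
  forall i t, D i -> 0 <= t <= T -> X i t - X' i t <= S0 * expR (- (c * t)).
Proof.
move=> s0 p0 c0 S00 cX cX' dXE dX'E subX superX' XB M'm MM' cle w0 i0 t0 Di0 t0T.
have B0 : 0 <= B by have [+ _] := XB i0 t0 Di0 t0T; exact: le_trans.
(* The sign of [m] is known only through a point of ]0, T[; when there is none, [t0] is 0. *)
have [[t1 t1T]|noT] := pselect (exists t, 0 < t < T); last first.
  have T0 : T <= 0.
    rewrite leNgt; apply/negP => T0; apply: noT; exists (T / 2).
    by rewrite divr_gt0//= ltr_pdivrMr// ltr_pMr// ltr1n.
  have -> : t0 = 0.
    by apply/le_anti; case/andP: t0T => -> /le_trans ->.
  by rewrite mulr0 oppr0 expR0 mulr1 w0.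
have m0 : 0 <= m by case/andP: (M'm _ t1T) => /le_trans; apply.
(* [B2] bounds w and [S0]; [B3] bounds the admissible [S], hence S - w <= B3 + 2 B. *)
set B2 := 2 * B + S0; set B3 := expR (c * T) * B2.
have B20 : 0 <= B2 by rewrite addr_ge0// mulr_ge0.
have B30 : 0 <= B3 by rewrite mulr_ge0// expR_ge0.
(* The two summands are the coefficients of S - w in [h2] (nonlocal term) and [h4] (damping). *)
pose A := m * expR B * expR (B3 + 2 * B) + sigma * p * expR (p * B).
apply: (@sup_gronwall R I D (fun i t => X i t - X' i t)
  (fun i t => dX i t - dX' i t) T c S0 B2 A) => //.
- by rewrite lerDr mulr_ge0.
- by rewrite addr_ge0// !mulr_ge0// expR_ge0.
- move=> i Di; apply: (@within_continuousB _ _ _ _ (X i)); [exact: cX|exact: cX'].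
- by move=> i t Di tT; apply: is_deriveB; [exact: dXE|exact: dX'E].
- move=> i t Di /(XB _ _ Di)[]; rewrite !ler_norml /B2; lra.
move=> i t S Di tT /andP[S_ge0 SB] wS.
have tT' : 0 <= t <= T by case/andP: tT => /ltW -> /ltW ->.
have [XBi X'Bi] := XB i t Di tT'.
have /andP[M'0 M'le] := M'm t tT.
have := subX i t Di tT; have := superX' i t Di tT.
have := MM' t S tT S_ge0 wS; have := wS i Di; have := cle i t Di tT.
have X'p : expR (p * X' i t) <= expR (p * B).
  by rewrite ler_expR ler_wpM2l//; move: X'Bi; rewrite ler_norml => /andP[].
have X'm : M' t * expR (- X' i t) <= m * expR B.
  by rewrite ler_pM// ?expR_ge0// ler_expR lerNl; move: X'Bi; rewrite ler_norml => /andP[].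
set w := X i t - X' i t.
have -> : X i t = X' i t + w by rewrite /w; lra.
rewrite (mulrDr p) (opprD (X' i t)) !expRD => cX'i wi MM dX'i dXi.
have e1 : 1 + p * w <= expR (p * w) by exact: expR_ge1Dx.
have e2 : expR (S - w) - 1 <= (S - w) * expR (B3 + 2 * B).
  apply: le_trans (expR_sub1_le _) _; rewrite ler_wpM2l ?subr_ge0// ler_expR.
  apply: lerD => //; move: XBi X'Bi; rewrite /w !ler_norml; lra.
have h1 : M t * (expR (- X' i t) * expR (- w)) <=
    M' t * expR (- X' i t) * expR (S - w).
  apply: (@le_trans _ _ ((expR S * M' t) * (expR (- X' i t) * expR (- w)))).
    by rewrite ler_wpM2r// mulr_ge0 ?expR_ge0.
  rewrite expRD; lra.
have h2 : M' t * expR (- X' i t) * (expR (S - w) - 1) <=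
    m * expR B * ((S - w) * expR (B3 + 2 * B)).
  apply: (@le_trans _ _ (M' t * expR (- X' i t) * ((S - w) * expR (B3 + 2 * B)))).
    by rewrite ler_wpM2l// mulr_ge0 ?expR_ge0.
  by rewrite ler_wpM2r// mulr_ge0 ?expR_ge0 ?subr_ge0.
have k0 : 0 <= sigma * expR (p * X' i t) by rewrite mulr_ge0 ?expR_ge0.
have h3 : sigma * expR (p * X' i t) * (p * w) <=
    sigma * expR (p * X' i t) * (expR (p * w) - 1).
  by rewrite ler_wpM2l//; lra.
have k1 : sigma * p * expR (p * X' i t) <= sigma * p * expR (p * B).
  by rewrite ler_wpM2l// mulr_ge0.
(* For w < 0 the excess of the slope over [c] has the wrong sign; since - w <= S - w it is absorbed
   by [A]. *)
have h4 : (sigma * p * expR (p * X' i t) - c) * (- w) <=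
    sigma * p * expR (p * B) * (S - w).
  apply: (@le_trans _ _ ((sigma * p * expR (p * X' i t) - c) * (S - w))).
    by rewrite ler_wpM2l ?subr_ge0//; lra.
  by rewrite ler_wpM2r ?subr_ge0//; lra.
rewrite /A; lra.
Qed.

(** * Supports and integrals of probability measures *)

Lemma probability1_setC d (T : measurableType d) (R : realType)
    (P : probability T R) (E : set T) :
  measurable E -> P E = 1%E -> P (~` E) = 0%E.
Proof. by move=> mE PE; rewrite probability_setC// PE subee. Qed.

(** Members of the family that are not null are replaced by the empty set, so the family can be a
    whole countable base of the topology. *)
Lemma probability_eq1_null_cover d (T : measurableType d) (R : realType)
    (P : probability T R) (J : countType) (U : J -> set T) (K : set T) :
  measurable K -> (forall j, measurable (U j)) ->
  (forall x, ~ K x -> exists j, U j x /\ P (U j) = 0%E) -> P K = 1%E.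
Proof.
move=> mK mU cover.
pose F n := if unpickle n is Some j then
  (if P (U j) == 0%E then U j else set0) else set0.
have : P.-negligible (~` K).
  apply: (@negligibleS _ _ _ _ (\bigcup_n F n)).
    move=> x /cover[j [Ujx Pj]]; exists (pickle j) => //.
    by rewrite /F pickleK Pj eqxx.
  apply: negligible_bigcup => n; rewrite /F.
  case: (unpickle n) => [j|]; last exact: negligible_set0.
  case: eqP => [Pj|_]; last exact: negligible_set0.
  by apply/negligibleP.
move/(measure_negligible (measurableC mK)) => PKC.
by rewrite -[K]setCK probability_setC ?PKC ?sube0//; exact: measurableC.
Qed.

Lemma open_rat_itv (R : realType) (V : set R) (x : R) : open V -> V x ->
  exists q : rat * rat,
    `]ratr q.1, ratr q.2[%classic x /\ `]ratr q.1, ratr q.2[ `<=` V.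
Proof.
move=> oV Vx.
have /nbhs_ballP[e /= e0 xeV] : nbhs x V by exact: open_nbhs_nbhs.
have [|q1 +] := @rat_in_itvoo R (x - e) x; first by rewrite ltrBlDr ltrDl.
rewrite in_itv/= => /andP[q1l q1r].
have [|q2 +] := @rat_in_itvoo R x (x + e); first by rewrite ltrDl.
rewrite in_itv/= => /andP[q2l q2r].
exists (q1, q2); split => /=; first by rewrite in_itv/= q1r q2l.
move=> z /=; rewrite in_itv/= => /andP[z1 z2]; apply: xeV.
rewrite /ball/= ltr_norml; lra.
Qed.

Definition rat_box (R : realType) (q : (rat * rat) * (rat * rat)) : set (R * R) :=
  `]ratr q.1.1, ratr q.1.2[ `*` `]ratr q.2.1, ratr q.2.2[.

Lemma measurable_rat_box (R : realType) q : measurable (@rat_box R q).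
Proof. by apply: measurableX; exact: measurable_itv. Qed.

Lemma open_rat_box (R : realType) (V : set (R * R)) (x : R * R) : open V -> V x ->
  exists q, @rat_box R q x /\ @rat_box R q `<=` V.
Proof.
move=> oV Vx.
have /nbhs_ballP[e /= e0 xeV] : nbhs x V by exact: open_nbhs_nbhs.
have [q1 [q1x q1V]] := open_rat_itv (ball_open x.1 e) (ballxx _ e0).
have [q2 [q2x q2V]] := open_rat_itv (ball_open x.2 e) (ballxx _ e0).
exists (q1, q2); split; first by split.
by move=> z [z1 z2]; apply: xeV; split; [exact: q1V|exact: q2V].
Qed.

(** The plane carries the product sigma-algebra; an open set belongs to it as the countable union of
    the rational boxes it contains. *)
Lemma open_measurable_plane (R : realType) (V : set (R * R)) :
  open V -> measurable V.
Proof.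
move=> oV.
have -> : V = \bigcup_q (if `[< @rat_box R q `<=` V >] then @rat_box R q else set0).
  apply/seteqP; split => [x Vx|x [q _]]; last by case: asboolP => // qV /qV.
  have [q [qx qV]] := open_rat_box oV Vx; exists q => //=.
  by case: asboolP.
apply: countable_bigcupT_measurable => // q.
by case: asboolP => // _; exact: measurable_rat_box.
Qed.

(** A point off the support has a null open neighbourhood, which contains a rational box around the
    point; countably many such null boxes cover the complement of [K]. *)
Lemma msupport_probability1_plane (R : realType) (P : probability (R * R)%type R)
    (K : set (R * R)) :
  measurable K -> msupport P `<=` K -> P K = 1%E.
Proof.
move=> mK PK; apply: (@probability_eq1_null_cover _ _ _ _ _ (@rat_box R)) => //.
  exact: measurable_rat_box.
move=> x Kx; have /existsNP[V] : ~ msupport P x by move=> /PK.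
move=> /not_implyP[oV /not_implyP[Vx /negP]]; rewrite -leNgt => PV.
have [q [qx qV]] := open_rat_box oV Vx; exists q; split => //.
apply/eqP; rewrite eq_le measure_ge0 andbT (le_trans _ PV)//.
apply: le_measure => //; rewrite inE; first exact: measurable_rat_box.
exact: open_measurable_plane.
Qed.

Lemma msupport_probability1_line (R : realType) (P : probability R R)
    (K : set R) :
  measurable K -> msupport P `<=` K -> P K = 1%E.
Proof.
move=> mK PK; apply: (@probability_eq1_null_cover _ _ _ _ _
  (fun q : rat * rat => [set` `]ratr q.1, (ratr q.2 : R)[])) => //.
move=> x Kx; have /existsNP[V] : ~ msupport P x by move=> /PK.
move=> /not_implyP[oV /not_implyP[Vx /negP]]; rewrite -leNgt => PV.
have [q [qx qV]] := open_rat_itv oV Vx; exists q; split => //.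
apply/eqP; rewrite eq_le measure_ge0 andbT (le_trans _ PV)//.
apply: le_measure => //; rewrite inE; first exact: measurable_itv.
exact: open_measurable.
Qed.

Lemma integral_probability1 d (T : measurableType d) (R : realType)
    (P : probability T R) (D E : set T) (f : T -> \bar R) :
  measurable D -> measurable E -> E `<=` D -> P E = 1%E -> P.-integrable D f ->
  (\int[P]_(x in D) f x = \int[P]_(x in E) f x)%E.
Proof.
move=> mD mE ED PE intf.
rewrite (@negligible_integral _ _ _ P D (~` E))//; last 2 first.
- exact: measurableC.
- exact: probability1_setC.
congr (integral _ _ _); apply/seteqP; split => x /=.
  by move=> [_ /contrapT].
by move=> Ex; split; [exact: ED|].
Qed.

Lemma Rintegral_probability1 d (T : measurableType d) (R : realType)
    (P : probability T R) (D E : set T) (f : T -> R) :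
  measurable D -> measurable E -> E `<=` D -> P E = 1%E ->
  P.-integrable D (EFin \o f) ->
  \int[P]_(x in D) f x = \int[P]_(x in E) f x.
Proof.
move=> mD mE ED PE intf.
by rewrite /Rintegral (@integral_probability1 _ _ _ P D E).
Qed.

Lemma Rintegral_probability_le d (T : measurableType d) (R : realType)
    (P : probability T R) (D E : set T) (f h : T -> R) :
  measurable D -> P D = 1%E -> measurable E -> P E = 1%E ->
  P.-integrable D (EFin \o f) -> P.-integrable D (EFin \o h) ->
  (forall x, D x -> E x -> f x <= h x) ->
  \int[P]_(x in D) f x <= \int[P]_(x in D) h x.
Proof.
move=> mD PD mE PE intf inth fh.
have mDE : measurable (D `&` E) by exact: measurableI.
have PDE : P (D `&` E) = 1%E.
  have : P (~` (D `&` E)) = 0%E.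
    apply: (measure_negligible (measurableC mDE)).
    rewrite setCI; apply: negligibleU; apply/negligibleP.
    - exact: measurableC.
    - exact: probability1_setC.
    - exact: measurableC.
    - exact: probability1_setC.
  move=> PDEC; rewrite -[D `&` E]setCK probability_setC ?PDEC ?sube0//.
  exact: measurableC.
rewrite !(@Rintegral_probability1 _ _ _ P D (D `&` E))//.
apply: le_Rintegral => //; last by move=> x [Dx Ex]; exact: fh.
- exact: (integrableS mD).
- exact: (integrableS mD).
Qed.

Lemma Rintegral_probability_cst d (T : measurableType d) (R : realType)
    (P : probability T R) (D : set T) (k : R) :
  measurable D -> P D = 1%E -> \int[P]_(x in D) k = k.
Proof. 
move=> mD PD; rewrite Rintegral_cst//.
by rewrite [X in k * X](_ : _ = 1) ?mulr1//; exact: (congr1 fine PD).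
 Qed.

(** * The logarithmic flow *)

Definition rectangle (R : realType) (ymin ymax thmin thmax : R) : set (R * R) :=
  `[ymin, ymax] `*` `[thmin, thmax].

Lemma measurable_rectangle (R : realType) (ymin ymax thmin thmax : R) :
  measurable (rectangle ymin ymax thmin thmax).
Proof. by apply: measurableX; exact: measurable_itv. Qed.

Lemma measurable_Omega (R : realType) : measurable (@Omega R).
Proof.
have -> : @Omega R = `]0, +oo[ `*` `]0, +oo[.
  by apply/seteqP; split => x; rewrite /Omega /= !in_itv/= !andbT.
by apply: measurableX; exact: measurable_itv.
Qed.

(* The characteristics in the variable [X = ln Y]. *)
Record log_flow (R : realType) (sigma p : R) (D : set (R * R))
    (mu0 : probability (R * R)%type R) (X : R * R -> R -> R) (M : R -> R) : Prop := {
  lf_measurable : measurable D;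
  lf_probability1 : mu0 D = 1%E;
  lf_integrable : forall t : R, 0 <= t ->
    mu0.-integrable D (EFin \o (fun q => expR (X q t)));
  lf_mean : forall t : R, 0 <= t -> M t = \int[mu0]_(q in D) expR (X q t);
  lf_mean_bounded : exists k, forall t : R, 0 <= t -> M t <= k;
  lf_init : forall q, D q -> X q 0 = ln q.1;
  lf_continuous : forall q, D q -> {within `[0, +oo[, continuous (X q)};
  lf_ode : forall q (t : R), D q -> 0 < t ->
    is_derive t 1 (X q)
      (M t * expR (- X q t) - 1 + sigma * (q.2 - expR (p * X q t))) }.

Lemma solution_log_flow (R : realType) (sigma p ymin ymax thmin thmax : R)
    (mu0 : probability (R * R)%type R) (mu : R -> probability (R * R)%type R)
    (Y : R -> R -> R -> R) (D := rectangle ymin ymax thmin thmax) :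
  0 < ymin -> 0 < thmin -> msupport mu0 `<=` D ->
  solution sigma p mu0 mu Y ->
  log_flow sigma p D mu0 (fun q t => ln (Y t q.1 q.2))
    (fun t => \int[mu0]_(q in D) Y t q.1 q.2).
Proof.
move=> ymin0 thmin0 sD solY.
have mD : measurable D by exact: measurable_rectangle.
have PD : mu0 D = 1%E by exact: msupport_probability1_plane.
have DO : D `<=` @Omega R.
  move=> q; rewrite /D /rectangle /Omega/= !in_itv/= => -[/andP[y0 _] /andP[th0 _]].
  by rewrite (lt_le_trans ymin0)// (lt_le_trans thmin0).
have charY := sol_characteristics solY.
have Y0 t q : 0 <= t -> D q -> 0 < Y t q.1 q.2.
  by move=> t0 /DO; case: q => y th; exact: (char_gt0 charY).
have lnY0 t q : 0 <= t -> D q -> expR (ln (Y t q.1 q.2)) = Y t q.1 q.2.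
  by move=> t0 Dq; rewrite lnK// posrE Y0.
have mO := @measurable_Omega R.
have intY t : 0 <= t -> mu0.-integrable D (EFin \o (fun q => Y t q.1 q.2)).
  by move=> t0; apply: (integrableS mO mD DO); exact: (char_integrable charY).
have [K [cK KO sK]] := sol_uniform_support solY.
(* Since [D] has mass one, the nonlocal term is the mean of Y minus the value at the point. *)
have meanB t z : 0 <= t -> \int[mu0]_(q in @Omega R) (Y t q.1 q.2 - z) =
    \int[mu0]_(q in D) Y t q.1 q.2 - z.
  move=> t0; rewrite (@Rintegral_probability1 _ _ _ mu0 (@Omega R) D)//; last first.
    apply: (@integrableB _ _ _ mu0 _ mO (fun q => (Y t q.1 q.2)%:E) (EFin \o cst z)); first exact: (char_integrable charY).
    exact: finite_measure_integrable_cst.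
  rewrite RintegralB//; last exact: finite_measure_integrable_cst.
  - by congr (_ - _); exact: Rintegral_probability_cst.
  - exact: intY.
split => //.
- move=> t t0; apply: eq_integrable (intY t t0) => // q.
  by rewrite inE => Dq /=; rewrite lnY0.
- by move=> t t0; apply: eq_Rintegral => q; rewrite inE => Dq; rewrite lnY0.
(* The compact set containing all the supports bounds the first coordinate; through the
   push-forward, Y <= k0 + 1 holds [mu0]-almost everywhere at each time, which bounds the mean. *)
- have [k0 [_ /(_ (k0 + 1))]] := compact_bounded cK.
  rewrite ltrDl ltr01 => /(_ isT) Kk.
  exists (k0 + 1) => t t0; rewrite -[leRHS](@Rintegral_probability_cst _ _ _ mu0 D)//.
  have mE : measurable [set q : R * R | Y t q.1 q.2 <= k0 + 1].
    have -> : [set q : R * R | Y t q.1 q.2 <= k0 + 1] =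
        [set: R * R] `&` (fun q => Y t q.1 q.2) @^-1` [set` `]-oo, k0 + 1]].
      by apply/seteqP; split => q /=; rewrite in_itv/= => // -[].
    by apply: (char_measurable charY) => //; exact: measurable_itv.
  apply: (@Rintegral_probability_le _ _ _ _ _ _ _ _ mD PD mE).
  + have mS : measurable ([set` `]-oo, k0 + 1]] `*` [set: R]).
      by apply: measurableX => //; exact: measurable_itv.
    have <- : mu t ([set` `]-oo, k0 + 1]] `*` [set: R]) = 1%E.
      apply: msupport_probability1_plane => // q /(sK t t0) /Kk qk.
      split => //=; rewrite in_itv/= (le_trans _ qk)//.
      by rewrite prod_normE le_max (ler_norm q.1).
    rewrite (sol_pushforward solY)//; congr (mu0 _).
    by apply/seteqP; split => q /=; rewrite in_itv/= => // -[].
  + exact: intY.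
  + exact: finite_measure_integrable_cst.
  + by move=> q _ /=.
- by move=> [y th] Dq /=; rewrite (char_init charY)//; exact: DO.
- move=> [y th] Dq /=.
  apply/subspace_continuousP => t; rewrite /= in_itv/= andbT => t0.
  apply: (@cvg_comp _ _ _ (fun t => Y t y th) (@ln R)).
    have /subspace_continuousP := char_continuous charY (DO _ Dq).
    by apply; rewrite /= in_itv/= t0.
  by apply: continuous_ln; exact: (Y0 t (y, th) t0 Dq).
- move=> [y th] t Dq t0 /=.
  have Yt0 := Y0 t _ (ltW t0) Dq; rewrite /= in Yt0.
  have dY := char_ode charY t0 (DO _ Dq).
  rewrite meanB ?ltW// in dY.
  have := is_derive1_comp (is_derive1_ln Yt0) dY.
  move=> /is_derive_eq; apply.
  rewrite expRN lnK ?posrE// /powR gt_eqF//.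
  by field; rewrite gt_eqF.
Qed.

Lemma lf_continuous_segment (R : realType) (sigma p : R) D mu0 X M q (T : R) :
  log_flow sigma p D mu0 X M -> D q -> {within `[0, T], continuous (X q)}.
Proof.
move=> flow Dq; apply: (continuous_subspaceW _ (lf_continuous flow Dq)) => t /=.
by rewrite !in_itv/= => /andP[->].
Qed.

Lemma lf_mean_ge0 (R : realType) (sigma p : R) D mu0 X M (t : R) :
  log_flow sigma p D mu0 X M -> 0 <= t -> 0 <= M t.
Proof.
move=> flow t0; rewrite (lf_mean flow)//.
by apply: Rintegral_ge0 => q _; exact: expR_ge0.
Qed.

Lemma lf_mean_le_cst (R : realType) (sigma p : R) D mu0 X M (t k : R) :
  log_flow sigma p D mu0 X M -> 0 <= t ->
  (forall q, D q -> expR (X q t) <= k) -> M t <= k.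
Proof.
move=> flow t0 Xk; have mD := lf_measurable flow; have PD := lf_probability1 flow.
rewrite (lf_mean flow)// -[leRHS](@Rintegral_probability_cst _ _ _ mu0 D)//.
apply: le_Rintegral => //; first exact: (lf_integrable flow t0).
exact: finite_measure_integrable_cst.
Qed.

Lemma lf_mean_ge_cst (R : realType) (sigma p : R) D mu0 X M (t k : R) :
  log_flow sigma p D mu0 X M -> 0 <= t ->
  (forall q, D q -> k <= expR (X q t)) -> k <= M t.
Proof.
move=> flow t0 Xk; have mD := lf_measurable flow; have PD := lf_probability1 flow.
rewrite (lf_mean flow)// -[leLHS](@Rintegral_probability_cst _ _ _ mu0 D)//.
apply: le_Rintegral => //; last exact: (lf_integrable flow t0).
exact: finite_measure_integrable_cst.
Qed.

Lemma Rintegral_expR_le d (T : measurableType d) (R : realType)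
    (P : measure T R) (D : set T) (u v : T -> R) (S : R) :
  measurable D -> P.-integrable D (EFin \o (fun x => expR (u x))) ->
  P.-integrable D (EFin \o (fun x => expR (v x))) ->
  (forall x, D x -> u x - v x <= S) ->
  \int[P]_(x in D) expR (u x) <= expR S * \int[P]_(x in D) expR (v x).
Proof.
move=> mD iu iv uv; rewrite -RintegralZl//.
apply: le_Rintegral => //; first exact: (integrableZl mD (expR S) iv).
by move=> x Dx; rewrite -expRD ler_expR -lerBlDr uv.
Qed.

Lemma lf_mean_le (R : realType) (sigma p : R) D mu0 X M (s t S : R) :
  log_flow sigma p D mu0 X M -> 0 <= s -> 0 <= t ->
  (forall q, D q -> X q s - X q t <= S) -> M s <= expR S * M t.
Proof.
move=> flow s0 t0 XS; rewrite !(lf_mean flow)//.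
apply: Rintegral_expR_le => //; first exact: (lf_measurable flow).
  exact: (lf_integrable flow s0).
exact: (lf_integrable flow t0).
Qed.

(** The a priori bound that [comparison] requires. With M <= k, each characteristic satisfies Y' <=
    k + b Y, which bounds X above; below, the nonlocal term is nonnegative and the damping is
    controlled by the upper bound. *)
Lemma lf_locally_bounded (R : realType) (sigma p ymin ymax thmin thmax : R)
    mu0 X M (T : R) (D := rectangle ymin ymax thmin thmax) :
  0 < sigma -> 0 < p -> 0 < ymin -> 0 < thmin -> 0 <= T ->
  log_flow sigma p D mu0 X M ->
  exists B, forall q t, D q -> 0 <= t <= T -> `|X q t| <= B.
Proof.
move=> s0 p0 ymin0 thmin0 T0 flow; have [k Mk] := lf_mean_bounded flow.
have k0 : 0 <= k by apply: le_trans (Mk 0 _) => //; exact: (lf_mean_ge0 flow).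
have DE q : D q -> [/\ ymin <= q.1, q.1 <= ymax, thmin <= q.2 & q.2 <= thmax].
  by rewrite /D /rectangle/= !in_itv/= => -[] /andP[? ?] /andP[? ?].
set b := sigma * `|thmax|.
have s_ge0 := ltW s0; have p_ge0 := ltW p0.
have b0 : 0 <= b by rewrite mulr_ge0.
set U := expR (b * T) * (`|ymax| + k * T).
have XU q t : D q -> 0 <= t <= T -> X q t <= U.
  move=> Dq /andP[t0 tT]; have [y1 y2 th1 th2] := DE q Dq.
  pose f t := expR (- b * t) * expR (X q t) - k * t.
  have : f t <= f 0.
    apply: (@nonincreasing_endpoints R f
      (fun t => expR (- b * t) * expR (X q t) * (- b +
      (M t * expR (- X q t) - 1 + sigma * (q.2 - expR (p * X q t)))) - k)) => //.
    - apply: (@within_continuousB _ _ _ _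
        (fun t => expR (- b * t) * expR (X q t)) (fun t => k * t)).
        apply: within_continuousM.
          apply: continuous_subspaceT => x.
          exact: (continuous_comp (@mulrl_continuous _ (- b) x) (@continuous_expR _ _)).
        move=> x; apply: continuous_comp; last exact: continuous_expR.
        exact: (lf_continuous_segment flow Dq).
      by apply: continuous_subspaceT => x; exact: mulrl_continuous.
    - move=> x /andP[x0 xt].
      have dX := lf_ode flow Dq x0.
      have ? : is_derive x 1 (fun s => expR (- b * s)) (expR (- b * x) * - b).
        apply: (@is_derive1_comp R expR (fun s => - b * s)).
        by apply: is_derive_eq; rewrite scaler1.
      have ? := @is_derive1_comp R expR (X q) _ _ _ (is_derive_expR _) dX.
      rewrite /f; apply: is_derive_eq.
      rewrite /GRing.scale/=; ring.
    - move=> x /andP[x0 xt]; rewrite subr_le0 -mulrA.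
      set e := expR (X q x) * _.
      have eM : e <= M x.
        have XX : expR (X q x) * expR (- X q x) = 1 by rewrite -expRD subrr expR0.
        rewrite /e !mulrDr [X in _ + (X + _ + _)]mulrCA XX.
        have : 0 <= expR (X q x) * (sigma * (`|thmax| - q.2)).
          by rewrite !mulr_ge0 ?expR_ge0// subr_ge0 (le_trans th2)// ler_norm.
        have : 0 <= expR (X q x) * (sigma * expR (p * X q x)).
          by rewrite !mulr_ge0 ?expR_ge0.
        have := expR_ge0 (X q x).
        rewrite /b; lra.
      have e1 : expR (- b * x) <= 1.
        by rewrite -expR0 ler_expR mulNr oppr_le0 mulr_ge0// ltW.
      have [e_le0|/ltW e_ge0] := leP e 0.
        by rewrite (le_trans _ k0)// mulr_ge0_le0 ?expR_ge0.
      rewrite (le_trans (ler_wpM2r e_ge0 e1))// mul1r (le_trans eM)//.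
      by rewrite Mk// ltW.
  rewrite /f !mulr0 expR0 mul1r subr0 (lf_init flow)// lnK; last first.
    by rewrite posrE (lt_le_trans ymin0).
  rewrite lerBlDr => ft.
  (* The estimate on Y is passed to X by X <= e^X. *)
  apply: (@le_trans _ _ (expR (X q t))).
    by apply: le_trans (expR_ge1Dx _); rewrite lerDr.
  rewrite -(ler_pM2l (expR_gt0 (- b * t))) (le_trans ft)// /U mulrA -expRD.
  apply: (@le_trans _ _ (1 * (`|ymax| + k * T))).
    by rewrite mul1r lerD// ?ler_wpM2l// (le_trans y2)// ler_norm.
  rewrite ler_wpM2r ?addr_ge0 ?mulr_ge0//.
  by rewrite -expR0 ler_expR mulNr addrC subr_ge0 ler_wpM2l.
set c := 1 + sigma * expR (p * U).
have XL q t : D q -> 0 <= t <= T -> - X q t <= - ln ymin + c * T.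
  move=> Dq /andP[t0 tT]; have [y1 y2 th1 th2] := DE q Dq.
  have c0 : 0 <= c by rewrite addr_ge0// mulr_ge0 ?expR_ge0.
  pose f t := - X q t - c * t.
  have : f t <= f 0.
    apply: (@nonincreasing_endpoints R f (fun t => -
      (M t * expR (- X q t) - 1 + sigma * (q.2 - expR (p * X q t))) - c)) => //.
    - apply: (@within_continuousB _ _ _ _ (fun t => - X q t) (fun t => c * t)).
        move=> x; apply: continuousN.
        exact: (lf_continuous_segment flow Dq).
      by apply: continuous_subspaceT => x; exact: mulrl_continuous.
    - move=> x /andP[x0 xt].
      have dX := lf_ode flow Dq x0.
      rewrite /f; apply: is_derive_eq.
      by rewrite /GRing.scale/= mulr1.
    - move=> x /andP[x0 xt].
      have : 0 <= M x * expR (- X q x).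
        by rewrite mulr_ge0 ?expR_ge0//; apply: (lf_mean_ge0 flow); exact: ltW.
      have : sigma * expR (p * X q x) <= sigma * expR (p * U).
        rewrite ler_pM2l// ler_expR ler_pM2l// XU// ltW//= (le_trans _ tT)//.
        exact: ltW.
      have : 0 <= sigma * q.2 by rewrite mulr_ge0// (le_trans (ltW thmin0)).
      rewrite /c; lra.
  rewrite /f mulr0 subr0 (lf_init flow)// => ft.
  have : ln ymin <= ln q.1 by rewrite ler_ln ?posrE// (lt_le_trans ymin0).
  have : c * t <= c * T by rewrite ler_wpM2l.
  lra.
exists (`|U| + `|- ln ymin + c * T|) => q t Dq tT.
rewrite ler_norml; have := XU q t Dq tT; have := XL q t Dq tT.
have := ler_norm U; have := ler_norm (- ln ymin + c * T).
have := normr_ge0 U; have := normr_ge0 (- ln ymin + c * T).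
lra.
Qed.

(** A constant a whose mean is taken to be e^a has zero nonlocal contribution, so the sign of theta
    - e^(p a) decides whether it is a sub- or a supersolution. The comparison is used with initial
    gap 0 and rate 0. *)
Lemma lf_bounds (R : realType) (sigma p ymin ymax thmin thmax alpha beta : R)
    mu0 X M (D := rectangle ymin ymax thmin thmax) :
  0 < sigma -> 0 < p -> 0 < ymin -> 0 < thmin ->
  alpha <= ln ymin -> expR (p * alpha) <= thmin ->
  ln ymax <= beta -> thmax <= expR (p * beta) ->
  log_flow sigma p D mu0 X M ->
  forall q t, D q -> 0 <= t -> alpha <= X q t <= beta.
Proof.
move=> s0 p0 ymin0 thmin0 ay ath yb thb flow q t Dq t0.
have s_ge0 := ltW s0; have p_ge0 := ltW p0.
have DE q' : D q' -> [/\ ymin <= q'.1, q'.1 <= ymax, thmin <= q'.2 & q'.2 <= thmax].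
  by rewrite /D /rectangle/= !in_itv/= => -[] /andP[? ?] /andP[? ?].
have [k Mk] := lf_mean_bounded flow.
have [B0 XB0] := lf_locally_bounded s0 p0 ymin0 thmin0 t0 flow.
set B := `|B0| + `|alpha| + `|beta|.
have XB q' s : D q' -> 0 <= s <= t -> `|X q' s| <= B.
  move=> Dq' st; apply: (le_trans (XB0 q' s Dq' st)).
  by rewrite /B -addrA (le_trans (ler_norm B0))// lerDl addr_ge0.
have cB (z : R) : {within `[0, t], continuous (fun=> z)}.
  by move=> x; exact: cst_continuous.
have ttt : 0 <= t <= t by rewrite t0 lexx.
apply/andP; split; rewrite -subr_le0 -(mul0r (expR (- (0 * t)))).
- apply: (@comparison R _ D snd sigma p (fun _ _ => alpha) X (fun _ _ => 0)
    (fun q t => M t * expR (- X q t) - 1 + sigma * (q.2 - expR (p * X q t)))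
    (fun=> expR alpha) M t 0 0 B k) => //.
  + by move=> q' Dq'; exact: (lf_continuous_segment flow).
  + by move=> q' s Dq' /andP[? _]; exact: (lf_ode flow).
  + move=> q' s Dq' _; have [_ _ th1 _] := DE q' Dq'.
    rewrite -expRD subrr expR0 subrr add0r mulr_ge0// subr_ge0.
    exact: le_trans th1.
  + move=> q' s Dq' st; split; last exact: XB.
    by rewrite /B addrAC lerDr addr_ge0.
  + move=> s /andP[/ltW ? _]; apply/andP; split; last exact: Mk.
    exact: (lf_mean_ge0 flow).
  + move=> s S /andP[/ltW ? _] S0 XS; rewrite -ler_pdivrMl ?expR_gt0// -expRN -expRD.
    apply: (lf_mean_ge_cst flow) => // q' Dq'; rewrite ler_expR.
    by have := XS q' Dq'; lra.
  + by move=> q' s Dq' _; rewrite !mulr_ge0 ?expR_ge0.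
  + move=> q' Dq'; have [y1 _ _ _] := DE q' Dq'.
    rewrite (lf_init flow)// subr_le0 (le_trans ay)// ler_ln ?posrE//.
    exact: lt_le_trans y1.
- apply: (@comparison R _ D snd sigma p X (fun _ _ => beta)
    (fun q t => M t * expR (- X q t) - 1 + sigma * (q.2 - expR (p * X q t)))
    (fun _ _ => 0) M (fun=> expR beta) t 0 0 B (expR beta)) => //.
  + by move=> q' Dq'; exact: (lf_continuous_segment flow).
  + by move=> q' s Dq' /andP[? _]; exact: (lf_ode flow).
  + move=> q' s Dq' _; have [_ _ _ th2] := DE q' Dq'.
    rewrite -expRD subrr expR0 subrr add0r pmulr_rle0// subr_le0.
    exact: le_trans thb.
  + move=> q' s Dq' st; split; first exact: XB.
    by rewrite /B lerDr addr_ge0.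
  + by move=> s _; rewrite expR_ge0 lexx.
  + move=> s S /andP[/ltW ? _] S0 XS; rewrite -expRD.
    apply: (lf_mean_le_cst flow) => // q' Dq'; rewrite ler_expR.
    by have := XS q' Dq'; rewrite lerBlDr.
  + by move=> q' s Dq' _; rewrite !mulr_ge0 ?expR_ge0.
  + move=> q' Dq'; have [y1 y2 _ _] := DE q' Dq'.
    have q10 := lt_le_trans ymin0 y1.
    rewrite (lf_init flow)// subr_le0 (le_trans _ yb)// ler_ln ?posrE//.
    exact: lt_le_trans y2.
Qed.

(** A time shift of a characteristic solves the same equation with the mean shifted alike, and the
    gap is at most beta - alpha at the start. No order between [h] and [h'] is imposed, so
    exchanging the roles gives two-sided bounds. *)
Lemma lf_contraction (R : realType) (sigma p ymin ymax thmin thmax alpha beta : R)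
    mu0 X M (D := rectangle ymin ymax thmin thmax) :
  0 < sigma -> 0 < p ->
  log_flow sigma p D mu0 X M ->
  (forall q t, D q -> 0 <= t -> alpha <= X q t <= beta) ->
  forall q q' (t h h' : R), D q -> D q' -> q.2 = q'.2 ->
  0 <= t -> 0 <= h -> 0 <= h' ->
  X q (t + h) - X q' (t + h') <=
    (beta - alpha) * expR (- (sigma * p * expR (p * alpha) * t)).
Proof.
move=> s0 p0 flow Xab q q' t h h' Dq Dq' qq' t0 h0 h'0.
have s_ge0 := ltW s0; have p_ge0 := ltW p0.
pose I := ((R * R) * (R * R))%type.
(* The index set contains the diagonal pairs (q, q), and these yield the comparison of the two
   means. *)
pose DD : set I := [set i | [/\ D i.1, D i.2 & i.1.2 = i.2.2]].
have cshift q0 (l : R) : D q0 -> 0 <= l ->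
    {within `[0, t], continuous (fun s => X q0 (s + l))}.
  (* The equation holds only for positive times; without a shift, continuity at 0 comes from the
     flow itself. *)
  move=> Dq0; rewrite le_eqVlt => /predU1P[<-|l0].
    rewrite (_ : (fun s => _) = X q0); first exact: (lf_continuous_segment flow).
    by apply/funext => s; rewrite addr0.
  apply: derivable_within_continuous => s; rewrite in_itv/= => /andP[sge0 _].
  have dX : is_derive (s + l) 1 (X q0) _ := lf_ode flow Dq0 (ltr_wpDl sge0 l0).
  have dsl : is_derive s 1 (fun s : R => s + l) 1.
    by apply: is_derive_eq; rewrite addr0.
  by have [] := @is_derive1_comp R (X q0) (fun s => s + l) s _ _ dX dsl.
have dshift q0 (l s : R) : D q0 -> 0 <= l -> 0 < s ->
    is_derive s 1 (fun s => X q0 (s + l)) (M (s + l) * expR (- X q0 (s + l)) - 1 +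
      sigma * (q0.2 - expR (p * X q0 (s + l)))).
  move=> Dq0 l0 s_gt0.
  have dX : is_derive (s + l) 1 (X q0) _ := lf_ode flow Dq0 (ltr_wpDr l0 s_gt0).
  have dsl : is_derive s 1 (fun s : R => s + l) 1.
    by apply: is_derive_eq; rewrite addr0.
  by have := @is_derive1_comp R (X q0) (fun s => s + l) s _ _ dX dsl; rewrite mulr1.
have ab : alpha <= beta by have /andP[] := Xab q 0 Dq (lexx _); exact: le_trans.
apply: (@comparison R I DD (fun i => i.1.2) sigma p
  (fun i s => X i.1 (s + h)) (fun i s => X i.2 (s + h'))
  (fun i s => M (s + h) * expR (- X i.1 (s + h)) - 1 +
      sigma * (i.1.2 - expR (p * X i.1 (s + h))))
  (fun i s => M (s + h') * expR (- X i.2 (s + h')) - 1 +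
      sigma * (i.2.2 - expR (p * X i.2 (s + h'))))
  (fun s => M (s + h)) (fun s => M (s + h')) t
  (sigma * p * expR (p * alpha)) (beta - alpha) (`|alpha| + `|beta|)
  (expR beta) _ _ _ _ _ _ _ _ _ _ _ _ _ _ _ (q, q') t) => //.
- by rewrite !mulr_ge0 ?expR_ge0.
- by rewrite subr_ge0.
- by move=> i [? ? _]; exact: cshift.
- by move=> i [? ? _]; exact: cshift.
- by move=> i s [? ? _] /andP[? _]; exact: dshift.
- by move=> i s [? ? _] /andP[? _]; exact: dshift.
- by move=> i s [_ _ ->].
- have XB q0 s : D q0 -> 0 <= s -> `|X q0 s| <= `|alpha| + `|beta|.
    move=> Dq0 sge0; have := Xab q0 s Dq0 sge0.
    rewrite ler_norml; have := ler_norm (- alpha); have := ler_norm beta.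
    have := normr_ge0 alpha; have := normr_ge0 beta; rewrite normrN; lra.
  by move=> i s [? ? _] /andP[? _]; split; apply: XB => //; rewrite addr_ge0.
- move=> s /andP[/ltW sge0 _]; have sh' := addr_ge0 sge0 h'0.
  rewrite (lf_mean_ge0 flow)//=.
  apply: (lf_mean_le_cst flow) => // q0 Dq0.
  by rewrite ler_expR; have /andP[] := Xab q0 (s + h') Dq0 sh'.
- move=> s S /andP[/ltW ? _] S0 XS.
  apply: (lf_mean_le flow); rewrite ?addr_ge0// => q0 Dq0.
  exact: (XS (q0, q0)).
- move=> i s [_ Di _] /andP[/ltW s_ge _]; rewrite ler_pM2l ?mulr_gt0// ler_expR.
  rewrite ler_pM2l//.
  by have /andP[] := Xab i.2 (s + h') Di (addr_ge0 s_ge h'0).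
- move=> i [D1 D2 _]; rewrite !add0r.
  have /andP[? ?] := Xab i.1 h D1 h0; have /andP[? ?] := Xab i.2 h' D2 h'0.
  exact: lerB.
- by rewrite t0 lexx.
Qed.

(** * Long-time limits and smooth profiles *)

Lemma exp_decay_small (R : realType) (C c e : R) : 0 < c -> 0 < e ->
  \forall t \near +oo, C * expR (- (c * t)) <= e.
Proof.
move=> c0 e0; exists (`|C| / (e * c)); split; first exact: num_real.
move=> t; rewrite ltr_pdivrMr ?mulr_gt0// => Ct.
rewrite -(ler_pM2l (expR_gt0 (c * t))) mulrCA -expRD subrr expR0 mulr1.
apply: (le_trans (ler_norm C)); apply: (le_trans (ltW Ct)).
have : e * (c * t) <= e * expR (c * t).
  by rewrite ler_pM2l//; apply: le_trans (expR_ge1Dx _); rewrite lerDr.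
lra.
Qed.

Lemma exp_decay_cvg (R : realType) (f : R -> R) (l C c : R) : 0 < c ->
  (forall t, 0 <= t -> `|f t - l| <= C * expR (- (c * t))) ->
  f t @[t --> +oo] --> l.
Proof.
move=> c0 fl; apply/cvgrPdist_le => e e0; near=> t.
rewrite distrC (le_trans (fl _ _))//.
by near: t; exact: exp_decay_small.
Unshelve. all: end_near. Qed.

(** The intervals of radius C e^(-c t) around f(t) meet pairwise; the supremum of their left ends
    lies in all of them, which gives the limit together with its rate. *)
Lemma exp_cauchy_limit (R : realType) (f : R -> R) (C c : R) :
  (forall t h h' : R, 0 <= t -> 0 <= h -> 0 <= h' ->
    f (t + h) - f (t + h') <= C * expR (- (c * t))) ->
  exists l, forall t, 0 <= t -> `|f t - l| <= C * expR (- (c * t)).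
Proof.
move=> fC; pose E := [set x | exists2 t, 0 <= t & x = f t - C * expR (- (c * t))].
have ubE t : 0 <= t -> ubound E (f t + C * expR (- (c * t))).
  move=> t0 _ [s s0 ->]; rewrite lerBlDr.
  have [st|/ltW ts] := leP s t.
    have := fC s 0 (t - s) s0 (lexx _); rewrite subr_ge0 addr0 (addrC s) subrK.
    (* Equal shifts show that C e^(-c t) is nonnegative. *)
    move=> /(_ st); have := fC t 0 0 t0 (lexx _) (lexx _).
    rewrite subrr; lra.
  have := fC t (s - t) 0 t0; rewrite subr_ge0 addr0 (addrC t) subrK.
  move=> /(_ ts (lexx _)); have := fC s 0 0 s0 (lexx _) (lexx _).
  rewrite subrr; lra.
have supE : has_sup E.
  split; first by exists (f 0 - C * expR (- (c * 0))); exists 0.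
  by exists (f 0 + C * expR (- (c * 0))); exact: ubE.
exists (sup E) => t t0; rewrite ler_distlC; apply/andP; split.
  by apply: sup_upper_bound => //; exists t.
by apply: ge_sup; [exact: supE.1|exact: ubE].
Qed.

(** The increment f(t + 1) - f(t) tends to 0 and is a value of [df] beyond t. This makes the limits
    of the characteristics stationary. *)
Lemma derivative_limit0 (R : realType) (f df : R -> R) (l r : R) :
  (forall t : R, 0 < t -> is_derive t 1 f (df t)) ->
  f t @[t --> +oo] --> l -> df t @[t --> +oo] --> r -> r = 0.
Proof.
move=> dfE fl dfr; apply/eqP; rewrite -normr_le0; apply/ler_addgt0Pl => e e0.
rewrite addr0; have e30 : 0 < e / 3 by rewrite divr_gt0.
have /cvgr_dist_le /(_ _ e30) := fl; have /cvgr_dist_le /(_ _ e30) := dfr.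
move=> -[A [_ PA]] [B [_ PB]].
pose t := Num.max (Num.max A B) 0 + 1.
have tA : A < t by rewrite /t ltr_pwDr// !le_max lexx.
have tB : B < t by rewrite /t ltr_pwDr// !le_max lexx orbT.
have t0 : 0 < t by rewrite /t ltr_wpDl// le_max lexx orbT.
have t0' y : t <= y -> 0 < y by exact: lt_le_trans.
have dfE' x : x \in `]t, (t + 1)[ -> is_derive x 1 f (df x).
  by rewrite in_itv/= => /andP[/ltW /t0' x0 _]; exact: dfE.
have cf : {within `[t, (t + 1)], continuous f}.
  apply: derivable_within_continuous => x; rewrite in_itv/= => /andP[/t0' x0 _].
  by have [] := dfE x x0.
have tt1 : t < t + 1 by rewrite ltrDl.
have [x + fx] := MVT tt1 dfE' cf.
rewrite in_itv/= => /andP[tx xt].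
have := PA x (lt_trans tA tx); have := PB t tB; have := PB (t + 1) (lt_trans tB tt1).
have -> : df x = f (t + 1) - f t by rewrite fx; lra.
rewrite !ler_norml; lra.
Qed.

Definition stationary (R : realType) (sigma p m th x : R) : Prop :=
  expR (m - x) - 1 + sigma * (th - expR (p * x)) = 0.

(** Derivative in x of e^(p x) + (1 - e^(m - x)) / sigma, the value of theta for which x is
    stationary. *)
Definition profile_slope (R : realType) (sigma p m x : R) : R :=
  p * expR (p * x) + sigma^-1 * expR (m - x).

(* An algebra of functions of [th] that is stable under differentiation when
   [G] is the inverse of a function with derivative [profile_slope]. *)
Inductive profile_algebra (R : realType) (sigma p m : R) (G : R -> R) :
  (R -> R) -> Prop :=
| profile_cst k : profile_algebra sigma p m G (fun=> k)
| profile_expR k : profile_algebra sigma p m G (fun th => expR (k * G th))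
| profile_slopeV :
    profile_algebra sigma p m G (fun th => (profile_slope sigma p m (G th))^-1)
| profile_add f1 f2 : profile_algebra sigma p m G f1 ->
    profile_algebra sigma p m G f2 ->
    profile_algebra sigma p m G (fun th => f1 th + f2 th)
| profile_mul f1 f2 : profile_algebra sigma p m G f1 ->
    profile_algebra sigma p m G f2 ->
    profile_algebra sigma p m G (fun th => f1 th * f2 th).

Lemma profile_slope_gt0 (R : realType) (sigma p m x : R) :
  0 < sigma -> 0 < p -> 0 < profile_slope sigma p m x.
Proof. by move=> s0 p0; rewrite addr_gt0// mulr_gt0 ?invr_gt0 ?expR_gt0. Qed.

Lemma profile_algebra_derive (R : realType) (sigma p m : R) (G : R -> R) f :
  0 < sigma -> 0 < p ->
  (forall th : R, is_derive th 1 G (profile_slope sigma p m (G th))^-1) ->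
  profile_algebra sigma p m G f ->
  exists2 f', profile_algebra sigma p m G f' &
    forall th : R, is_derive th 1 f (f' th).
Proof.
move=> s0 p0 dG.
have dexp (k th : R) : is_derive th 1 (fun th => expR (k * G th))
    (k * expR (k * G th) * (profile_slope sigma p m (G th))^-1).
  have ? : is_derive th 1 (fun th => k * G th)
      (k * (profile_slope sigma p m (G th))^-1).
    by have := dG th => ?; apply: is_derive_eq.
  apply: is_derive_eq (@is_derive1_comp R expR (fun th => k * G th) th _ _ _ _) _.
  by rewrite mulrCA mulrA.
elim=> {f} [k|k||f1 f2 _ [f1' A1 d1] _ [f2' A2 d2]|
    f1 f2 B1 [f1' A1 d1] B2 [f2' A2 d2]].
- by exists (fun=> 0) => [|th]; [exact: profile_cst|exact: is_derive_cst].
- exists (fun th => k * expR (k * G th) * (profile_slope sigma p m (G th))^-1) => //.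
  do 2 (apply: profile_mul; last by constructor); exact: profile_cst.
(* The derivative of the slope along [G], with e^(m - G) split as e^m e^(- G) so that only
   generators of the algebra occur. *)
- pose ds th := (p * p * expR (p * G th) + - (sigma^-1 * expR m) * expR (- 1 * G th)) *
    (profile_slope sigma p m (G th))^-1.
  exists (fun th => - 1 * ds th *
    ((profile_slope sigma p m (G th))^-1 * (profile_slope sigma p m (G th))^-1)).
    repeat (constructor || apply: profile_mul || apply: profile_add).
  move=> th.
  have slopeE : (fun th => profile_slope sigma p m (G th)) =
      (fun th => p * expR (p * G th) + (sigma^-1 * expR m) * expR (- 1 * G th)).
    by apply/funext => z; rewrite /profile_slope expRD mulN1r mulrA.
  have dslope : is_derive th 1 (fun th => profile_slope sigma p m (G th)) (ds th).
    rewrite slopeE.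
    have d1 := dexp p th; have d2 := dexp (- 1) th.
    apply: is_derive_eq; rewrite /GRing.scale/= /ds; ring.
  have sn0 : profile_slope sigma p m (G th) != 0.
    by rewrite gt_eqF// profile_slope_gt0.
  have [der val] := dslope.
  split; first exact: derivableV.
  rewrite deriveV// val /GRing.scale/= expr2 invfM; ring.
- exists (fun th => f1' th + f2' th); first exact: profile_add.
  by move=> th; exact: is_deriveD.
- exists (fun th => f1' th * f2 th + f1 th * f2' th).
    by apply: profile_add; exact: profile_mul.
  move=> th; apply: is_derive_eq (is_deriveM (d1 th) (d2 th)) _.
  by rewrite /GRing.scale/= addrC [f2 th * _]mulrC.
Qed.

Lemma profile_algebra_smooth (R : realType) (sigma p m : R) (G : R -> R) f :
  0 < sigma -> 0 < p ->
  (forall th : R, is_derive th 1 G (profile_slope sigma p m (G th))^-1) ->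
  profile_algebra sigma p m G f -> smooth (f : R^o -> R).
Proof.
move=> s0 p0 dG Af s.
suff : profile_algebra sigma p m G
    (foldr (fun v (h : R^o -> R^o) => 'D_v h) (f : R^o -> R^o) s).
  move=> /(profile_algebra_derive s0 p0 dG)[f' _ df'] x.
  by apply/derivable1_diffP; have [] := df' x.
elim: s => //= v s /(profile_algebra_derive s0 p0 dG)[f' Af' df'].
set h := foldr _ _ _ in df' *.
(* [smooth] allows arbitrary directions; on the line a directional derivative is a multiple of the
   ordinary one, so the iterates stay in the algebra. *)
have -> : 'D_v h = (fun th => v * f' th).
  apply/funext => x; have [hx hx'] := df' x.
  have dh : differentiable (h : R^o -> R^o) x by apply/derivable1_diffP.
  rewrite deriveE// -[v in LHS](mulr1 v) -[v * 1]/(v *: (1 : R^o)) linearZ/=.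
  by rewrite -deriveE// hx'.
by apply: profile_mul => //; exact: profile_cst.
Qed.

(** The left-hand side of the stationary equation increases with m and theta and decreases strictly
    with x. Applied both ways to equal data, this is uniqueness of the stationary point. *)
Lemma stationary_mono (R : realType) (sigma p m m' th th' x x' : R) :
  0 < sigma -> 0 < p -> m <= m' -> th <= th' ->
  stationary sigma p m th x -> stationary sigma p m' th' x' -> x <= x'.
Proof.
rewrite /stationary => s0 p0 mm' thth' e e'; rewrite leNgt; apply/negP => x'x.
have : expR (m - x) < expR (m' - x') by rewrite ltr_expR ler_ltD// ltrN2.
have : sigma * (th - expR (p * x)) < sigma * (th' - expR (p * x')).
  by rewrite ltr_pM2l// ler_ltD// ltrN2 ltr_expR ltr_pM2l.
lra.
Qed.

Lemma stationary_lt (R : realType) (sigma p m th th' x x' : R) :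
  0 < sigma -> 0 < p -> th < th' ->
  stationary sigma p m th x -> stationary sigma p m th' x' -> x < x'.
Proof.
move=> s0 p0 thth' e e'.
rewrite lt_neqAle (stationary_mono s0 p0 (lexx m) (ltW thth') e e') andbT.
apply/eqP => xx'; move: e e'; rewrite /stationary -xx' => e e'.
have : sigma * th < sigma * th' by rewrite ltr_pM2l.
lra.
Qed.

Lemma stationary_exists (R : realType) (sigma p m th : R) : 0 < sigma -> 0 < p ->
  exists x, stationary sigma p m th x.
Proof.
move=> s0 p0; pose f x := sigma * expR (p * x) + 1 - expR m * expR (- x).
(* By e^x >= 1 + x, at - z the term e^(m - x) outweighs the rest of [f], and at [b] the term sigma
   e^(p x) does; so [f] takes the value sigma theta in between. *)
pose z := (sigma + 1 + `|sigma * th|) / expR m.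
pose b := (`|sigma * th| + expR m) / (sigma * p).
have z0 : 0 <= z by rewrite divr_ge0 ?expR_ge0// !addr_ge0// ltW.
have b0 : 0 <= b by rewrite divr_ge0 ?addr_ge0 ?expR_ge0// ltW// mulr_gt0.
have cf : continuous f.
  move=> x; apply: cvgB; first apply: cvgD; last first.
  - apply: cvgM; first exact: cvg_cst.
    by apply: continuous_comp; [exact: opp_continuous|exact: continuous_expR].
  - exact: cvg_cst.
  - apply: cvgM; first exact: cvg_cst.
    by apply: continuous_comp; [exact: mulrl_continuous|exact: continuous_expR].
have fz : f (- z) <= sigma * th.
  have : expR (p * - z) <= 1.
    by rewrite -expR0 ler_expR mulrN oppr_le0 mulr_ge0// ltW.
  rewrite -(ler_pM2l s0) => h1; rewrite /f opprK.
  have : expR m * (1 + z) <= expR m * expR z.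
    by rewrite ler_pM2l ?expR_gt0// expR_ge1Dx.
  rewrite mulrDr /z mulrCA divff ?gt_eqF ?expR_gt0// mulr1.
  have := ler_norm (- (sigma * th)); rewrite normrN; have := expR_gt0 m.
  lra.
have fb : sigma * th <= f b.
  have : expR (- b) <= 1 by rewrite -expR0 ler_expR oppr_le0.
  rewrite -(ler_pM2l (expR_gt0 m)) => h1.
  have : sigma * (1 + p * b) <= sigma * expR (p * b).
    by rewrite ler_pM2l// expR_ge1Dx.
  rewrite mulrDr mulrA /b mulrCA divff ?gt_eqF ?mulr_gt0// mulr1 -/b.
  have := ler_norm (sigma * th); rewrite /f.
  lra.
have zb : - z <= b by rewrite (le_trans _ b0)// oppr_le0.
have [||c _ fc] := @IVT R f (- z) b (sigma * th) zb.
- by apply: continuous_subspaceT => x; exact: cf.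
- by rewrite ge_min le_max fz fb orbT.
by exists c; rewrite /stationary expRD; move: fc; rewrite /f; lra.
Qed.

Lemma stationary_profile (R : realType) (sigma p m : R) : 0 < sigma -> 0 < p ->
  exists G : R -> R, (forall th, stationary sigma p m th (G th)) /\
    smooth ((fun th => expR (G th)) : R^o -> R).
Proof.
move=> s0 p0; have [G GE] := choice (fun th => stationary_exists m th s0 p0).
exists G; split => //.
(* The stationary equation solved for theta; uniqueness and existence of stationary points make [G]
   its two-sided inverse. *)
pose H x := expR (p * x) + sigma^-1 * (1 - expR (m - x)).
have HE x : stationary sigma p m (H x) x.
  by rewrite /stationary /H; field; rewrite gt_eqF.
have HK : cancel H G.
  by move=> x; apply/le_anti; rewrite !(stationary_mono s0 p0 (lexx m) (lexx (H x))).
have GK th : H (G th) = th.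
  have := GE th; rewrite /stationary /H => e.
  have -> : 1 - expR (m - G th) = sigma * (th - expR (p * G th)) by lra.
  by rewrite mulrA mulVf ?gt_eqF//; ring.
have dH (x : R) : is_derive x 1 H (profile_slope sigma p m x).
  have d1 : is_derive x 1 (fun x => expR (p * x)) (expR (p * x) * p).
    apply: (@is_derive1_comp R expR (fun s => p * s)).
    by apply: is_derive_eq; rewrite scaler1.
  have d2 : is_derive x 1 (fun x => expR (m - x)) (expR (m - x) * - 1).
    apply: (@is_derive1_comp R expR (fun s => m - s)).
    by apply: is_derive_eq; rewrite add0r mul1r.
  rewrite /H; apply: is_derive_eq.
  rewrite /GRing.scale/= /profile_slope; ring.
apply: (@profile_algebra_smooth _ sigma p m G) => //.
  move=> th; rewrite -[X in is_derive X](GK th).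
  have HG : {near G th, cancel H G} by near=> x; exact: HK.
  have cH : \forall x \near G th, {for x, continuous H}.
    near=> x; apply: differentiable_continuous.
    by apply/derivable1_diffP; have [] := dH x.
  apply: (is_derive_inverse HG cH (dH _)).
  by rewrite gt_eqF// profile_slope_gt0.
rewrite (_ : (fun th => expR (G th)) = (fun th => expR (1 * G th))).
  exact: profile_expR.
by apply/funext => th; rewrite mul1r.
Unshelve. all: end_near. Qed.

Lemma cvg_bounds (R : realType) (f : R -> R) (a b l : R) :
  (forall t, 0 <= t -> a <= f t <= b) -> f t @[t --> +oo] --> l -> a <= l <= b.
Proof.
move=> fab fl; apply/andP; split.
  apply: (ler_cvg_to (cvg_cst a) fl); near=> t.
  have /fab/andP[//] : 0 <= t by near: t; exact: nbhs_pinfty_ge.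
apply: (ler_cvg_to fl (cvg_cst b)); near=> t.
have /fab/andP[//] : 0 <= t by near: t; exact: nbhs_pinfty_ge.
Unshelve. all: end_near. Qed.

Lemma smooth_continuous (R : realType) (f : R -> R) :
  smooth (f : R^o -> R) -> continuous f.
Proof. by move=> sf x; apply: differentiable_continuous; exact: (sf [::] x). Qed.

Lemma profile_integrable (R : realType) (ymin ymax thmin thmax beta : R)
    (mu0 : probability (R * R)%type R) (G : R -> R)
    (D := rectangle ymin ymax thmin thmax) :
  smooth ((fun th => expR (G th)) : R^o -> R) ->
  (forall th, thmin <= th <= thmax -> G th <= beta) ->
  mu0.-integrable D (EFin \o (fun q => expR (G q.2))).
Proof.
move=> Gsmooth Gb; have mD := measurable_rectangle ymin ymax thmin thmax.
apply: measurable_bounded_integrable => //.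
- exact: (le_lt_trans (probability_le1 mu0 mD) (ltry 1)).
- apply: (measurable_funS measurableT) => //.
  apply: (measurableT_comp (continuous_measurable_fun (smooth_continuous Gsmooth))).
  exact: measurable_snd.
- exists (expR beta); split => [|x xb q [_ qth] /=]; first exact: num_real.
  by rewrite ger0_norm ?expR_ge0// ltW// (le_lt_trans _ xb)// ler_expR Gb.
Qed.

Lemma lf_limit (R : realType) (sigma p ymin ymax thmin thmax alpha beta : R)
    mu0 X M (D := rectangle ymin ymax thmin thmax)
    (c := sigma * p * expR (p * alpha)) :
  0 < sigma -> 0 < p -> D !=set0 ->
  log_flow sigma p D mu0 X M ->
  (forall q t, D q -> 0 <= t -> alpha <= X q t <= beta) ->
  exists m G, [/\ forall th, stationary sigma p m th (G th),
    smooth ((fun th => expR (G th)) : R^o -> R),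
    forall q t, D q -> 0 <= t ->
      `|X q t - G q.2| <= (beta - alpha) * expR (- (c * t)),
    forall th, thmin <= th <= thmax -> alpha <= G th <= beta &
    expR m = \int[mu0]_(q in D) expR (G q.2)].
Proof.
move=> s0 p0 [q0 Dq0] flow Xab; have mD := lf_measurable flow.
have c0 : 0 < c by rewrite !mulr_gt0 ?expR_gt0.
have contr := lf_contraction s0 p0 flow Xab.
have Mge t : 0 <= t -> expR alpha <= M t.
  move=> t0; apply: (lf_mean_ge_cst flow) => // q Dq.
  by rewrite ler_expR; have /andP[] := Xab q t Dq t0.
have M0 t : 0 <= t -> 0 < M t by move=> /Mge; apply: lt_le_trans; exact: expR_gt0.
have [m mE] : exists m, forall t, 0 <= t ->
    `|ln (M t) - m| <= (beta - alpha) * expR (- (c * t)).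
  apply: exp_cauchy_limit => t h h' t0 h0 h'0.
  have th0 := addr_ge0 t0 h0; have th'0 := addr_ge0 t0 h'0.
  (* The mean inherits the contraction of the characteristics in its logarithm, so ln M converges at
     the same rate. *)
  rewrite lerBlDr -ler_expR expRD !lnK ?posrE ?M0//.
  by apply: (lf_mean_le flow) => // q Dq; exact: contr.
have mcvg : ln (M t) @[t --> +oo] --> m by exact: exp_decay_cvg mE.
have [G [GE Gsmooth]] := stationary_profile m s0 p0.
have XG q t : D q -> 0 <= t ->
    `|X q t - G q.2| <= (beta - alpha) * expR (- (c * t)).
  move=> Dq; have [l lE] : exists l, forall t, 0 <= t ->
      `|X q t - l| <= (beta - alpha) * expR (- (c * t)).
    by apply: exp_cauchy_limit => ? ? ? ? ? ?; exact: contr.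
  have lcvg : X q t @[t --> +oo] --> l by exact: exp_decay_cvg lE.
  (* Uniqueness of the stationary point shows that the limit depends on theta alone. *)
  suff lS : stationary sigma p m q.2 l.
    suff -> : G q.2 = l by exact: lE.
    by apply/le_anti; rewrite !(stationary_mono s0 p0 (lexx m) (lexx q.2)).
  apply: (derivative_limit0 (fun s s0 => lf_ode flow Dq s0) lcvg).
  apply: (@cvg_trans _ ((fun s => expR (ln (M s) - X q s) - 1 +
      sigma * (q.2 - expR (p * X q s))) @ +oo)).
    apply: near_eq_cvg; near=> s; rewrite expRD lnK ?posrE ?M0//.
  apply: cvgD.
    apply: cvgB; last exact: cvg_cst.
    by apply: (cvg_comp _ _ (cvgB mcvg lcvg)); exact: continuous_expR.
  apply: cvgM; first exact: cvg_cst.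
  apply: cvgB; first exact: cvg_cst.
  by apply: (cvg_comp _ _ (cvgM (cvg_cst p) lcvg)); exact: continuous_expR.
have Gab th : thmin <= th <= thmax -> alpha <= G th <= beta.
  move=> thD; have Dq : D (q0.1, th) by case: Dq0 => ? _; split.
  apply: (@cvg_bounds _ (X (q0.1, th))) => [t t0|]; first exact: Xab.
  exact: exp_decay_cvg (fun t => XG _ t Dq).
exists m, G; split => //.
have intG : mu0.-integrable D (EFin \o (fun q => expR (G q.2))).
  have Gb th : thmin <= th <= thmax -> G th <= beta by move=> /Gab/andP[].
  exact: profile_integrable Gb.
(* M / I and I / M are at most e^S with S decaying to 0, so ln M tends to ln I as well as to m. *)
set I := \int[mu0]_(q in D) _.
have IM t : 0 <= t -> M t <= expR ((beta - alpha) * expR (- (c * t))) * I.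
  move=> t0; rewrite (lf_mean flow)//; apply: Rintegral_expR_le => //.
    exact: (lf_integrable flow).
  by move=> q Dq; apply: (le_trans (ler_norm _)); exact: XG.
have MI t : 0 <= t -> I <= expR ((beta - alpha) * expR (- (c * t))) * M t.
  move=> t0; rewrite (lf_mean flow)//; apply: Rintegral_expR_le => //.
    exact: (lf_integrable flow).
  by move=> q Dq; apply: (le_trans (ler_norm _)); rewrite distrC; exact: XG.
have I0 : 0 < I.
  have := lt_le_trans (M0 0 (lexx _)) (IM 0 (lexx _)).
  by rewrite pmulr_rgt0 ?expR_gt0.
have lnI : ln (M t) @[t --> +oo] --> ln I.
  apply: (exp_decay_cvg (C := beta - alpha) c0) => t t0.
  set S := _ * expR _.
  have h1 : ln (M t) <= S + ln I.
    by rewrite -ler_expR expRD !lnK ?posrE ?M0// IM.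
  have h2 : ln I <= S + ln (M t).
    by rewrite -ler_expR expRD !lnK ?posrE ?M0// MI.
  rewrite ler_norml; lra.
have -> : m = ln I by apply: (cvg_unique _ mcvg lnI).
by rewrite lnK.
Unshelve. all: end_near. Qed.

(** * Wasserstein estimates *)

Lemma probability1_bounded_integrable d (T : measurableType d) (R : realType)
    (P : probability T R) (E : set T) (f : T -> R) :
  measurable E -> P E = 1%E -> measurable_fun setT f ->
  [bounded f x | x in E] -> P.-integrable setT (EFin \o f).
Proof.
move=> mE PE mf bf.
apply/(@negligible_integrable _ _ _ P setT (~` E)) => //.
- exact: measurableC.
- exact/measurable_EFinP.
- exact: probability1_setC.
rewrite setTD setCK; apply: measurable_bounded_integrable => //.
  exact: (le_lt_trans (probability_le1 P mE) (ltry 1)).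
exact: measurable_funS mf.
Qed.

Lemma lipschitz1_le (R : realType) (phi : R -> R) (x y : R) :
  1.-lipschitz (phi : R^o -> R^o) -> `|phi x - phi y| <= `|x - y|.
Proof. by move=> /(_ (x, y) (conj I I)) /=; rewrite mul1r. Qed.

Lemma lipschitz1_measurable (R : realType) (phi : R -> R) :
  1.-lipschitz (phi : R^o -> R^o) -> measurable_fun setT phi.
Proof.
move=> lphi; apply: continuous_measurable_fun => x.
apply/cvgrPdist_le => e e0; near=> y.
rewrite (le_trans (lipschitz1_le _ _ lphi))//.
Unshelve. all: end_near. Qed.

(** A 1-Lipschitz function stays within r of its value at a on an interval carrying [nu], hence so
    does its mean. *)
Lemma W1_dirac_le (R : realType) (nu : probability R R) (a r : R) :
  nu `[a - r, a + r]%classic = 1%E -> (W1 nu \d_a <= r%:E)%E.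
Proof.
move=> nuB; set B := `[a - r, a + r]%classic in nuB.
have mB : measurable B by exact: measurable_itv.
apply: ge_ereal_sup => _ [phi lphi <-].
have mphi := lipschitz1_measurable lphi.
have Bphi x : B x -> `|phi x - phi a| <= r.
  rewrite /B/= in_itv/= => xB; apply: (le_trans (lipschitz1_le _ _ lphi)).
  by rewrite ler_distl.
have int_phi : nu.-integrable setT (EFin \o phi).
  apply: (probability1_bounded_integrable mB nuB) => //.
  exists (`|phi a| + r); split => [|M rM x /Bphi phix]; first exact: num_real.
  rewrite /= (le_trans _ (ltW rM))// -[phi x](subrK (phi a)).
  by rewrite (le_trans (ler_normD _ _))// addrC lerD2l.
have int_B : nu.-integrable B (EFin \o phi) by exact: integrableS int_phi.
rewrite integral_dirac//; last exact/measurable_EFinP.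
rewrite diracT mul1e (@integral_probability1 _ _ _ nu setT B)//.
have -> : (\int[nu]_(x in B) (phi x)%:E = (\int[nu]_(x in B) phi x)%:E)%E.
  by rewrite fineK//; exact: integrable_fin_num.
rewrite -EFinB abse_EFin lee_fin ler_distl.
have cstE k : \int[nu]_(x in B) k = k by exact: Rintegral_probability_cst.
apply/andP; split.
  rewrite -[leLHS]cstE; apply: le_Rintegral => //.
    exact: finite_measure_integrable_cst.
  by move=> x /Bphi; rewrite ler_distl => /andP[].
rewrite -[leRHS]cstE; apply: le_Rintegral => //.
  exact: finite_measure_integrable_cst.
by move=> x /Bphi; rewrite ler_distl => /andP[].
Qed.

Lemma integral_theta_marginal (R : realType) (mu0 : probability (R * R)%type R)
    (D : set (R * R)) (phi : R -> R) :
  measurable D -> mu0 D = 1%E -> measurable_fun setT phi ->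
  [bounded phi q.2 | q in D] ->
  (\int[theta_marginal mu0]_x (phi x)%:E =
   (\int[mu0]_(q in D) phi q.2)%:E)%E.
Proof.
move=> mD PD mphi bphi.
have mphi2 : measurable_fun setT (fun q : R * R => phi q.2).
  by apply: measurableT_comp => //; exact: measurable_snd.
have int_phi : mu0.-integrable setT (EFin \o (fun q : R * R => phi q.2)).
  exact: (probability1_bounded_integrable mD PD).
rewrite integral_pushforward//; last exact/measurable_EFinP.
rewrite preimage_setT (@integral_probability1 _ _ _ mu0 setT D)//.
rewrite fineK//; apply: integrable_fin_num => //.
exact: integrableS int_phi.
Qed.

Lemma eq_integral_theta_marginal (R : realType)
    (mu0 mu0' : probability (R * R)%type R) (phi : R -> \bar R) :
  (forall A, measurable A -> theta_marginal mu0 A = theta_marginal mu0' A) ->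
  (\int[theta_marginal mu0]_x phi x = \int[theta_marginal mu0']_x phi x)%E.
Proof.
by move=> mu00'; apply: eq_measure_integral => A mA _; exact: mu00'.
Qed.

(** * Dependence of the profile on the marginal *)

Definition clamp (R : realType) (a b x : R) : R := Num.max a (Num.min x b).

Lemma clamp_id (R : realType) (a b x : R) : a <= x <= b -> clamp a b x = x.
Proof. by move=> /andP[ax xb]; rewrite /clamp min_l// max_r. Qed.

Lemma clamp_itv (R : realType) (a b x : R) : a <= b -> a <= clamp a b x <= b.
Proof. by move=> ab; rewrite /clamp le_max lexx/= ge_max ab ge_min lexx orbT. Qed.

Lemma clamp_le (R : realType) (a b x y : R) : a <= b -> x <= y ->
  0 <= clamp a b y - clamp a b x <= y - x.
Proof.
rewrite /clamp; case: (leP x b) => xb; case: (leP y b) => yb;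
  case: (leP a x) => ax; case: (leP a y) => ay; case: (leP a b) => ab; lra.
Qed.

(** W1 is tested on functions that are 1-Lipschitz on the whole line, while e^G is controlled only
    on an interval: projecting onto the interval extends it, dividing by L normalizes it. *)
Lemma lipschitz_clamp (R : realType) (a b L : R) (f : R -> R) : 0 < L -> a <= b ->
  (forall x y, a <= x <= b -> a <= y <= b -> x <= y ->
    `|f y - f x| <= L * (y - x)) ->
  1.-lipschitz ((fun x => f (clamp a b x) / L) : R^o -> R^o).
Proof.
move=> L0 ab fL.
have key x y : x <= y -> `|f (clamp a b y) / L - f (clamp a b x) / L| <= y - x.
  move=> xy; rewrite -mulrBl normrM [X in _ * X]gtr0_norm ?invr_gt0//.
  rewrite ler_pdivrMr// mulrC.
  have /andP[c0 cxy] := clamp_le ab xy.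
  apply: (@le_trans _ _ (L * (clamp a b y - clamp a b x))).
    by apply: fL; rewrite ?clamp_itv// -subr_ge0.
  by rewrite ler_pM2l.
move=> [x y] _ /=; rewrite mul1r.
have [xy|/ltW yx] := leP x y; last by rewrite [leRHS]ger0_norm ?subr_ge0 ?key.
by rewrite distrC [leRHS]distrC [leRHS]ger0_norm ?subr_ge0 ?key.
Qed.

Lemma expR_sub_ge (R : realType) (a x y : R) : a <= x -> x <= y ->
  expR a * (y - x) <= expR y - expR x.
Proof.
move=> ax xy; have -> : y = x + (y - x) by lra.
rewrite expRD [in leLHS](addrC x) addrK.
have h := expR_ge1Dx (y - x).
have : expR x * (1 + (y - x)) <= expR x * expR (y - x) by rewrite ler_pM2l ?expR_gt0.
have : expR a * (y - x) <= expR x * (y - x) by rewrite ler_wpM2r ?subr_ge0// ler_expR.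
lra.
Qed.

Lemma expR_sub_le (R : realType) (b x y : R) : x <= y -> y <= b ->
  expR y - expR x <= expR b * (y - x).
Proof.
move=> xy yb; have := expR_ge1Dx (x - y) => h.
have : expR y * (1 + (x - y)) <= expR y * expR (x - y) by rewrite ler_pM2l ?expR_gt0.
rewrite -expRD (addrC y) subrK.
have : expR y * (y - x) <= expR b * (y - x) by rewrite ler_wpM2r ?subr_ge0// ler_expR.
lra.
Qed.

(** Since e^(m - x) decreases in x, subtracting the equations leaves e^(p x') - e^(p x) <= th' - th.
    The left side is at least p e^(p alpha) (x' - x), and e^x' - e^x is at most e^beta (x' - x). *)
Lemma stationary_lipschitz (R : realType) (sigma p m alpha beta th th' x x' : R) :
  0 < sigma -> 0 < p -> th <= th' ->
  stationary sigma p m th x -> stationary sigma p m th' x' ->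
  alpha <= x -> x' <= beta ->
  `|expR x' - expR x| <= expR beta / (p * expR (p * alpha)) * (th' - th).
Proof.
move=> s0 p0 thth' e e' ax x'b.
have xx' := stationary_mono s0 p0 (lexx m) thth' e e'.
have pxx' : p * x <= p * x' by rewrite ler_pM2l.
rewrite ger0_norm ?subr_ge0 ?ler_expR//.
apply: (le_trans (expR_sub_le xx' x'b)).
rewrite -mulrA ler_pM2l ?expR_gt0// ler_pdivlMl ?mulr_gt0 ?expR_gt0//.
have pax : p * alpha <= p * x by rewrite ler_pM2l.
have := expR_sub_ge pax pxx'; rewrite -mulrBr.
have mx : expR (m - x') <= expR (m - x) by rewrite ler_expR lerB.
have : sigma * (expR (p * x') - expR (p * x)) <= sigma * (th' - th).
  by move: e e'; rewrite /stationary; lra.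
rewrite ler_pM2l//; lra.
Qed.

(* Subtracting the two equations and bounding the exponentials by their slopes at
   the ends of the range gives [B * (x - x') <= A * ((m - m') - (x - x'))]. *)
Lemma stationary_contraction (R : realType)
    (sigma p alpha beta m m' th x x' : R)
    (A := expR (beta - alpha)) (B := sigma * p * expR (p * alpha)) :
  0 < sigma -> 0 < p -> m' <= m ->
  stationary sigma p m th x -> stationary sigma p m' th x' ->
  alpha <= x <= beta -> alpha <= x' <= beta ->
  alpha <= m' -> m <= beta ->
  0 <= x - x' <= A / (A + B) * (m - m').
Proof.
move=> s0 p0 m'm e e' /andP[ax xb] /andP[ax' x'b] am' mb.
have x'x := stationary_mono s0 p0 m'm (lexx th) e' e.
have B0 : 0 < B by rewrite !mulr_gt0 ?expR_gt0.
have A0 : 0 < A by rewrite expR_gt0.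
rewrite subr_ge0 x'x/= mulrAC ler_pdivlMr ?addr_gt0//.
set s := m - m'; set d := x - x'.
have px'x : p * x' <= p * x by rewrite ler_pM2l.
have pax' : p * alpha <= p * x' by rewrite ler_pM2l.
have h1 : B * d <= sigma * (expR (p * x) - expR (p * x')).
  rewrite /B -!mulrA ler_pM2l//.
  by apply: le_trans (expR_sub_ge pax' px'x); rewrite -mulrBr -/d; lra.
have h2 : sigma * (expR (p * x) - expR (p * x')) = expR (m - x) - expR (m' - x').
  by move: e e'; rewrite /stationary; lra.
have mx : m' - x' <= m - x.
  by rewrite -ler_expR -subr_ge0 -h2 pmulr_rge0// subr_ge0 ler_expR.
have h3 : expR (m - x) - expR (m' - x') <= A * (m - x - (m' - x')).
  by apply: expR_sub_le => //; lra.
have -> : d * (A + B) = B * d + A * d by lra.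
move: h3; have -> : m - x - (m' - x') = s - d by rewrite /s /d; lra.
lra.
Qed.

Lemma profile_stability (R : realType)
    (sigma p ymin ymax thmin thmax alpha beta m m' : R)
    (mu0 mu0' : probability (R * R)%type R) (G G' : R -> R)
    (D := rectangle ymin ymax thmin thmax)
    (A := expR (beta - alpha)) (B := sigma * p * expR (p * alpha)) :
  0 < sigma -> 0 < p -> mu0 D = 1%E -> mu0' D = 1%E ->
  (forall th, stationary sigma p m th (G th)) ->
  (forall th, stationary sigma p m' th (G' th)) ->
  smooth ((fun th => expR (G th)) : R^o -> R) ->
  smooth ((fun th => expR (G' th)) : R^o -> R) ->
  (forall th, thmin <= th <= thmax -> alpha <= G th <= beta) ->
  (forall th, thmin <= th <= thmax -> alpha <= G' th <= beta) ->
  expR m = \int[mu0]_(q in D) expR (G q.2) ->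
  expR m' = \int[mu0']_(q in D) expR (G' q.2) ->
  m' <= m ->
  forall th, thmin <= th <= thmax ->
    `|expR (G th) - expR (G' th)| <= expR beta * ((A + B) / (B * expR alpha)) *
      (\int[mu0]_(q in D) expR (G q.2) - \int[mu0']_(q in D) expR (G q.2)).
Proof.
move=> s0 p0 PD PD' Gs Gs' Gsm Gsm' Gab Gab' mE mE' m'm th thD.
have mD : measurable D by exact: measurable_rectangle.
have A0 : 0 < A by exact: expR_gt0.
have B0 : 0 < B by rewrite !mulr_gt0 ?expR_gt0.
have Gb t : thmin <= t <= thmax -> G t <= beta by move=> /Gab/andP[].
have Gb' t : thmin <= t <= thmax -> G' t <= beta by move=> /Gab'/andP[].
have intG : mu0.-integrable D (EFin \o (fun q => expR (G q.2))).
  exact: profile_integrable Gb.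
have intG1 : mu0'.-integrable D (EFin \o (fun q => expR (G q.2))).
  exact: profile_integrable Gb.
have intG' : mu0'.-integrable D (EFin \o (fun q => expR (G' q.2))).
  exact: profile_integrable Gb'.
have mb : m <= beta.
  rewrite -ler_expR mE -[leRHS](@Rintegral_probability_cst _ _ _ mu0 D)//.
  apply: le_Rintegral => //; first exact: finite_measure_integrable_cst.
  by move=> q [_ qth]; rewrite ler_expR Gb.
have am' : alpha <= m'.
  rewrite -ler_expR mE' -[leLHS](@Rintegral_probability_cst _ _ _ mu0' D)//.
  apply: le_Rintegral => //; first exact: finite_measure_integrable_cst.
  by move=> q [_ qth]; rewrite ler_expR; have /andP[] := Gab' _ qth.
set s := m - m'; set k := A / (A + B).
have GG' t : thmin <= t <= thmax -> 0 <= G t - G' t <= k * s.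
  move=> tD; apply: (stationary_contraction s0 p0 m'm (Gs t) (Gs' t)) => //.
    exact: Gab.
  exact: Gab'.
set J := \int[mu0']_(q in D) expR (G q.2).
have JE : J <= expR (k * s) * expR m'.
  rewrite mE'; apply: Rintegral_expR_le => // q [_ qth].
  by have /andP[] := GG' _ qth.
have s_ge0 : 0 <= s by rewrite subr_ge0.
have k1 : 1 - k = B / (A + B).
  by rewrite /k; field; rewrite gt_eqF// addr_gt0.
have k_ge0 : 0 <= k by rewrite divr_ge0// ltW// addr_gt0.
have k_le1 : k <= 1 by rewrite -subr_ge0 k1 divr_ge0// ltW// addr_gt0.
(* [J] is at most e^(k s + m'), whose exponent falls short of m by (1 - k) s; the exponential has
   slope at least e^alpha there. As 1 - k = B / (A + B), this is the origin of the constant. *)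
have h1 : expR alpha * ((1 - k) * s) <= expR m - J.
  have h : alpha <= k * s + m' by rewrite (le_trans am')// lerDr mulr_ge0.
  have h' : k * s + m' <= m.
    have : k * s <= 1 * s by rewrite ler_wpM2r.
    by rewrite /s; lra.
  have := expR_sub_ge h h'.
  have -> : m - (k * s + m') = (1 - k) * s by rewrite /s; lra.
  move/le_trans; apply; rewrite lerB// (le_trans JE)//.
  by rewrite -expRD.
have /andP[d0 dks] := GG' _ thD.
have G'G : G' th <= G th by rewrite -subr_ge0.
rewrite ger0_norm ?subr_ge0 ?ler_expR//.
apply: (le_trans (expR_sub_le G'G (Gb _ thD))).
rewrite -mulrA ler_pM2l ?expR_gt0//.
have ds : G th - G' th <= s.
  by apply: (le_trans dks); rewrite -[leRHS]mul1r ler_wpM2r.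
apply: (le_trans ds); rewrite -mE mulrAC ler_pdivlMr ?mulr_gt0 ?expR_gt0//.
have -> : s * (B * expR alpha) = (A + B) * (expR alpha * ((1 - k) * s)).
  by rewrite k1; field; rewrite gt_eqF// addr_gt0.
by rewrite ler_pM2l// addr_gt0.
Qed.

(** A real bound [delta] on all test functions replaces W1: it serves both for a finite W1 and, with
    value 0, for equal marginals. *)
Lemma profile_stability_lipschitz (R : realType)
    (sigma p ymin ymax thmin thmax alpha beta m m' delta : R)
    (mu0 mu0' : probability (R * R)%type R) (G G' : R -> R)
    (D := rectangle ymin ymax thmin thmax)
    (A := expR (beta - alpha)) (B := sigma * p * expR (p * alpha))
    (L := expR beta / (p * expR (p * alpha))) :
  0 < sigma -> 0 < p -> thmin <= thmax -> mu0 D = 1%E -> mu0' D = 1%E ->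
  (forall th, stationary sigma p m th (G th)) ->
  (forall th, stationary sigma p m' th (G' th)) ->
  smooth ((fun th => expR (G th)) : R^o -> R) ->
  smooth ((fun th => expR (G' th)) : R^o -> R) ->
  (forall th, thmin <= th <= thmax -> alpha <= G th <= beta) ->
  (forall th, thmin <= th <= thmax -> alpha <= G' th <= beta) ->
  expR m = \int[mu0]_(q in D) expR (G q.2) ->
  expR m' = \int[mu0']_(q in D) expR (G' q.2) ->
  m' <= m ->
  (forall phi : R -> R, 1.-lipschitz (phi : R^o -> R^o) ->
    `|\int[mu0]_(q in D) phi q.2 - \int[mu0']_(q in D) phi q.2| <= delta) ->
  forall th, thmin <= th <= thmax -> `|expR (G th) - expR (G' th)| <=
    expR beta * ((A + B) / (B * expR alpha)) * L * delta.
Proof.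
move=> s0 p0 thm PD PD' Gs Gs' Gsm Gsm' Gab Gab' mE mE' m'm Hdelta th thD.
have mD : measurable D by exact: measurable_rectangle.
have B0 : 0 < B by rewrite !mulr_gt0 ?expR_gt0.
have L0 : 0 < L by rewrite divr_gt0 ?mulr_gt0 ?expR_gt0.
apply: (le_trans (profile_stability s0 p0 PD PD' Gs Gs' Gsm Gsm' Gab Gab' mE mE' m'm thD)).
rewrite -[leRHS]mulrA ler_pM2l; last first.
  by rewrite mulr_gt0 ?divr_gt0 ?addr_gt0 ?mulr_gt0 ?expR_gt0.
have Gb t : thmin <= t <= thmax -> G t <= beta by move=> /Gab/andP[].
have lphi : 1.-lipschitz
    ((fun x => expR (G (clamp thmin thmax x)) / L) : R^o -> R^o).
  apply: (lipschitz_clamp (f := fun x => expR (G x)) L0 thm) => x y xD yD xy.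
  apply: (stationary_lipschitz s0 p0 xy (Gs x) (Gs y)); last exact: Gb.
  by have /andP[] := Gab _ xD.
have phiE (nu : probability (R * R)%type R) :
    \int[nu]_(q in D) (expR (G (clamp thmin thmax q.2)) / L) =
    L^-1 * \int[nu]_(q in D) expR (G q.2).
  rewrite -RintegralZl//; last exact: profile_integrable Gb.
  apply: eq_Rintegral => q; rewrite inE => -[_ qth].
  by rewrite clamp_id// mulrC.
have := Hdelta _ lphi; rewrite !phiE -mulrBr => /(le_trans (ler_norm _)).
by rewrite ler_pdivrMl.
Qed.

(* The exponentials of these two numbers are constant barriers, below and above,
   for all the characteristics issued from the rectangle. *)
Definition log_lower (R : realType) (p ymin thmin : R) : R :=
  Num.min (ln ymin) (ln thmin / p).

Definition log_upper (R : realType) (p ymax thmax : R) : R :=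
  Num.max (ln ymax) (ln thmax / p).

Lemma solution_limit (R : realType) (sigma p ymin ymax thmin thmax : R)
    (mu0 : probability (R * R)%type R) (mu : R -> probability (R * R)%type R)
    (Y : R -> R -> R -> R) (D := rectangle ymin ymax thmin thmax)
    (alpha := log_lower p ymin thmin) (beta := log_upper p ymax thmax)
    (c := sigma * p * expR (p * alpha)) :
  0 < sigma -> 0 < p -> 0 < ymin -> 0 < thmin -> msupport mu0 `<=` D ->
  solution sigma p mu0 mu Y ->
  D !=set0 /\ mu0 D = 1%E /\
  exists m G, [/\ forall th, stationary sigma p m th (G th),
    smooth ((fun th => expR (G th)) : R^o -> R),
    forall q t, D q -> 0 <= t ->
      `|Y t q.1 q.2 - expR (G q.2)| <= expR beta * (beta - alpha) * expR (- (c * t)),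
    forall th, thmin <= th <= thmax -> alpha <= G th <= beta &
    expR m = \int[mu0]_(q in D) expR (G q.2)].
Proof.
move=> s0 p0 ymin0 thmin0 sD solY.
have flow := solution_log_flow ymin0 thmin0 sD solY; rewrite -/D in flow.
have PD := lf_probability1 flow.
(* The rectangle carries mass one; nonemptiness also supplies the sign of [thmax]. *)
have D0 : D !=set0.
  apply/set0P/eqP => DE; move: PD; rewrite DE measure0 => /eqP.
  by rewrite eq_sym onee_eq0.
split=> //; split=> //; have [q0 [q01 q02]] := D0.
move: q01 q02; rewrite /= !in_itv/= => /andP[y1 y2] /andP[th1 th2].
have thmax0 : 0 < thmax by rewrite (lt_le_trans thmin0)// (le_trans th1).
have h1 : alpha <= ln ymin by rewrite ge_min lexx.
have h2 : expR (p * alpha) <= thmin.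
  rewrite -[leRHS](lnK thmin0) ler_expR mulrC -ler_pdivlMr//.
  by rewrite ge_min lexx orbT.
have h3 : ln ymax <= beta by rewrite le_max lexx.
have h4 : thmax <= expR (p * beta).
  rewrite -[leLHS](lnK thmax0) ler_expR mulrC -ler_pdivrMr//.
  by rewrite le_max lexx orbT.
have Xab := lf_bounds s0 p0 ymin0 thmin0 h1 h2 h3 h4 flow.
have [m [G [Gs Gsm XG Gab mE]]] := lf_limit s0 p0 D0 flow Xab.
exists m, G; split => // q t Dq t0.
have Y0 : 0 < Y t q.1 q.2.
  apply: (char_gt0 (sol_characteristics solY)) => //.
  case: Dq => /=; rewrite !in_itv/= => /andP[yq _] /andP[thq _].
  by split; [exact: lt_le_trans yq|exact: lt_le_trans thq].
have /andP[_ Xb] := Xab q t Dq t0.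
have /andP[_ Gb] := Gab q.2 Dq.2.
rewrite -[X in `|X - _|](lnK Y0) -mulrA.
have lipE x y : x <= beta -> y <= beta ->
    `|expR x - expR y| <= expR beta * `|x - y|.
  move=> xb yb; have [xy|/ltW yx] := leP x y.
    rewrite distrC ger0_norm ?subr_ge0 ?ler_expR// [`|x - y|]distrC.
    by rewrite ger0_norm ?subr_ge0// expR_sub_le.
  by rewrite !ger0_norm ?subr_ge0 ?ler_expR// expR_sub_le.
apply: (le_trans (lipE _ _ Xb Gb)); rewrite ler_pM2l ?expR_gt0//.
exact: XG.
Qed.

Lemma msupport_theta_marginal (R : realType) (ymin ymax thmin thmax : R)
    (mu0 : probability (R * R)%type R) :
  mu0 (rectangle ymin ymax thmin thmax) = 1%E ->
  msupport (theta_marginal mu0) `<=` `[thmin, thmax].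
Proof.
move=> PD th sth; apply: contrapT => thD.
have mD := measurable_rectangle ymin ymax thmin thmax.
have oC : open (~` `[thmin, thmax]%classic).
  by apply: closed_openC; exact: interval_closed.
have := sth _ oC thD.
have -> : theta_marginal mu0 (~` `[thmin, thmax]%classic) = 0%E.
  apply: (@subset_measure0 _ _ _ mu0 _ (~` rectangle ymin ymax thmin thmax)).
  - rewrite -[X in measurable X]setTI.
    by apply: measurable_snd => //; apply: measurableC; exact: measurable_itv.
  - exact: measurableC.
  - by move=> q qth [_ q2]; exact: qth.
  - exact: probability1_setC.
by rewrite ltxx.
Qed.

Lemma W1_theta_marginal_ge (R : realType) (ymin ymax thmin thmax : R)
    (mu0 mu0' : probability (R * R)%type R) (phi : R -> R)
    (D := rectangle ymin ymax thmin thmax) :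
  mu0 D = 1%E -> mu0' D = 1%E -> 1.-lipschitz (phi : R^o -> R^o) ->
  (`|\int[mu0]_(q in D) phi q.2 - \int[mu0']_(q in D) phi q.2|%:E <=
    W1 (theta_marginal mu0) (theta_marginal mu0'))%E /\
  ((forall A, measurable A -> theta_marginal mu0 A = theta_marginal mu0' A) ->
    \int[mu0]_(q in D) phi q.2 = \int[mu0']_(q in D) phi q.2).
Proof.
move=> PD PD' lphi; have mD : measurable D by exact: measurable_rectangle.
have mphi := lipschitz1_measurable lphi.
have bphi : [bounded phi q.2 | q in D].
  exists (`|phi thmin| + (thmax - thmin)).
  split => [|M rM q [_]]; first exact: num_real.
  rewrite /= in_itv/= => /andP[q1 q2].
  rewrite (le_trans _ (ltW rM))// -[phi q.2](subrK (phi thmin)).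
  rewrite (le_trans (ler_normD _ _))// addrC lerD2l.
  rewrite (le_trans (lipschitz1_le _ _ lphi))// ger0_norm ?subr_ge0//.
  by rewrite lerB.
have E := integral_theta_marginal mD PD mphi bphi.
have E' := integral_theta_marginal mD PD' mphi bphi.
split.
  by apply: ereal_sup_ubound; exists phi => //; rewrite E E' -EFinB abse_EFin.
move=> /(eq_integral_theta_marginal (EFin \o phi)); rewrite /comp E E'.
by case.
Qed.

Lemma solution_conditional_concentration (R : realType)
    (sigma p ymin ymax : R)
    (mu0 : probability (R * R)%type R) (mu : R -> probability (R * R)%type R)
    (Y : R -> R -> R -> R) (nu : R -> R -> probability R R) (t th a r : R) :
  solution sigma p mu0 mu Y ->
  conditional_measures ymin ymax (theta_marginal mu0) mu Y nu ->
  0 <= t -> msupport (theta_marginal mu0) th ->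
  (forall y, ymin <= y <= ymax -> `|Y t y th - a| <= r) ->
  (W1 (nu t th) \d_a <= r%:E)%E.
Proof.
move=> solY condY t0 sth Yr; apply: W1_dirac_le.
rewrite (cond_pushforward condY)// /pushforward.
(* This preimage contains [ymin, ymax], which carries the initial fibre. *)
set E := _ @^-1` _.
have mY : measurable_fun setT (fun y => Y t y th).
  apply: (measurableT_comp (f := fun q => Y t q.1 q.2) (g := fun y => (y, th))).
    exact: (char_measurable (sol_characteristics solY)).
  exact: measurable_pair2.
have mE : measurable E.
  by rewrite -[E]setTI; apply: mY => //; exact: measurable_itv.
have mI : measurable `[ymin, ymax]%classic by exact: measurable_itv.
have PI := msupport_probability1_line mI (cond_support0 condY sth).
apply/eqP; rewrite eq_le probability_le1//= -PI; apply: le_measure; rewrite ?inE//.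
by move=> y /=; rewrite !in_itv/= => /Yr; rewrite ler_distl.
Qed.

Theorem theorem1p2 (R : realType) (sigma p ymin ymax thmin thmax : R)
    (sigma_gt0 : 0 < sigma) (p_gt0 : 0 < p)
    (ymin_gt0 : 0 < ymin) (thmin_gt0 : 0 < thmin) :
  (forall mu0 : probability (R * R)%type R,
    msupport mu0 `<=` `[ymin, ymax] `*` `[thmin, thmax] ->
    exists C c : R, [/\ 0 < C, 0 < c &
      forall (mu : R -> probability (R * R)%type R) (Y : R -> R -> R -> R),
        solution sigma p mu0 mu Y ->
        exists g : R -> R,
          [/\ smooth_on `[thmin, thmax] g,
              {in `[thmin, thmax] &, {homo g : x y / x < y}},
              long_time_limit ymin ymax thmin thmax Y g &
              forall nu : R -> R -> probability R R,
                conditional_measures ymin ymax (theta_marginal mu0) mu Y nu ->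
                forall t, 0 < t ->
                  (ereal_sup [set W1 (nu t th) \d_(g th)
                             | th in msupport (theta_marginal mu0)]
                   <= (C * expR (- (c * t)))%:E)%E]]) /\
  (sigma * thmin > (p + 1) / p \/ thmax / thmin < p + 1 ->
    exists C : R, 0 < C /\
      forall (mu0 mu0' : probability (R * R)%type R)
        (mu mu' : R -> probability (R * R)%type R)
        (Y Y' : R -> R -> R -> R) (g g' : R -> R),
        msupport mu0 `<=` `[ymin, ymax] `*` `[thmin, thmax] ->
        msupport mu0' `<=` `[ymin, ymax] `*` `[thmin, thmax] ->
        solution sigma p mu0 mu Y -> solution sigma p mu0' mu' Y' ->
        long_time_limit ymin ymax thmin thmax Y g ->
        long_time_limit ymin ymax thmin thmax Y' g' ->
        (ereal_sup [set `|g th - g' th|%:E | th in `[thmin, thmax]]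
         <= C%:E * W1 (theta_marginal mu0) (theta_marginal mu0'))%E /\
        ((forall A, measurable A ->
            theta_marginal mu0 A = theta_marginal mu0' A) ->
         forall th, thmin <= th <= thmax -> g th = g' th)).
Proof.
pose alpha := log_lower p ymin thmin; pose beta := log_upper p ymax thmax.
pose B := sigma * p * expR (p * alpha).
have B0 : 0 < B by rewrite !mulr_gt0 ?expR_gt0.
split=> [mu0 sD|_].
  (* [C] must be positive before any solution is given, when the rectangle may still be empty or a
     single point. *)
  pose C := expR beta * (`|beta - alpha| + 1).
  exists C, B; split => //; first by rewrite mulr_gt0 ?expR_gt0// ltr_wpDl.
  move=> mu Y solY.
  have [D0 [PD [m [G [Gs Gsm YG Gab mE]]]]] :=
    solution_limit sigma_gt0 p_gt0 ymin_gt0 thmin_gt0 sD solY.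
  have YC y th t : ymin <= y <= ymax -> thmin <= th <= thmax -> 0 <= t ->
      `|Y t y th - expR (G th)| <= C * expR (- (B * t)).
    move=> yD thD t0; apply: (le_trans (YG (y, th) t _ t0)).
      by split; rewrite /= in_itv.
    rewrite ler_wpM2r ?expR_ge0// ler_pM2l ?expR_gt0//.
    by rewrite (le_trans (ler_norm _))// lerDl.
  exists (fun th => expR (G th)); split.
  - by exists (fun th => expR (G th)).
  - by move=> th th' _ _ thth'; rewrite ltr_expR; exact: stationary_lt (Gs th) (Gs th').
  - by move=> y th yD thD; apply: (exp_decay_cvg B0) => t; exact: YC.
  - move=> nu condY t t0; apply: ge_ereal_sup => _ [th sth <-].
    have thD := msupport_theta_marginal PD sth; rewrite /= in_itv/= in thD.
    apply: (solution_conditional_concentration solY condY (ltW t0) sth) => y yD.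
    exact: YC yD thD (ltW t0).
pose A := expR (beta - alpha).
(* The first factor is the stability constant of the profile, the second the Lipschitz constant of
   e^G. *)
pose C := expR beta * ((A + B) / (B * expR alpha)) *
  (expR beta / (p * expR (p * alpha))).
have C0 : 0 < C by rewrite !(mulr_gt0, invr_gt0, addr_gt0, expR_gt0).
exists C; split => // mu0 mu0' mu mu' Y Y' g g' sD sD' solY solY' Yg Yg'.
have [[q0 [q01 q02]] [PD [m [G [Gs Gsm YG Gab mE]]]]] :=
  solution_limit sigma_gt0 p_gt0 ymin_gt0 thmin_gt0 sD solY.
have [_ [PD' [m' [G' [Gs' Gsm' YG' Gab' mE']]]]] :=
  solution_limit sigma_gt0 p_gt0 ymin_gt0 thmin_gt0 sD' solY'.
move: (q01) (q02); rewrite /= !in_itv/= => y0 /andP[th1 th2].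
have thm := le_trans th1 th2.
(* By uniqueness of limits, any long-time limit agrees with the exponential profile on the whole
   interval of theta. *)
have gE (Z : R -> R -> R -> R) (h H : R -> R) :
    long_time_limit ymin ymax thmin thmax Z h ->
    (forall q t, rectangle ymin ymax thmin thmax q -> 0 <= t ->
      `|Z t q.1 q.2 - expR (H q.2)| <=
        expR beta * (beta - alpha) * expR (- (B * t))) ->
    forall th, thmin <= th <= thmax -> h th = expR (H th).
  move=> Zh ZH th thD; apply: (cvg_unique _ (Zh q0.1 th y0 thD)) => //.
  by apply: (exp_decay_cvg B0) => t; apply: (ZH (q0.1, th)); split; rewrite /= in_itv.
have {}gE' := gE _ _ _ Yg' YG'; have {}gE := gE _ _ _ Yg YG.
have key delta : (forall phi : R -> R, 1.-lipschitz (phi : R^o -> R^o) ->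
      `|\int[mu0]_(q in rectangle ymin ymax thmin thmax) phi q.2 -
        \int[mu0']_(q in rectangle ymin ymax thmin thmax) phi q.2| <= delta) ->
    forall th, thmin <= th <= thmax -> `|g th - g' th| <= C * delta.
  move=> Hd th thD; rewrite gE// gE'//.
  have [m'm|/ltW mm'] := leP m' m.
    exact: (profile_stability_lipschitz sigma_gt0 p_gt0 thm PD PD' Gs Gs'
      Gsm Gsm' Gab Gab' mE mE' m'm).
  (* The estimate is stated for ordered means; here the two solutions exchange roles. *)
  rewrite distrC; apply: (profile_stability_lipschitz sigma_gt0 p_gt0 thm PD' PD
    Gs' Gs Gsm' Gsm Gab' Gab mE' mE mm') => // phi lphi.
  by rewrite distrC; exact: Hd.
split.
  (* W1 is an extended real: an infinite value makes the bound trivial, and the zero test function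
     excludes -oo. *)
  have [W|W] := eqVneq (W1 (theta_marginal mu0) (theta_marginal mu0')) +oo%E.
    by rewrite W mulry gtr0_sg// mul1e leey.
  have Wfin : W1 (theta_marginal mu0) (theta_marginal mu0') \is a fin_num.
    rewrite fin_numE W andbT gt_eqF//.
    have l0 : 1.-lipschitz ((fun=> 0) : R^o -> R^o).
      by move=> x _ /=; rewrite subrr normr0 mulr_ge0.
    have [+ _] := W1_theta_marginal_ge PD PD' l0.
    exact: lt_le_trans (ltNyr _).
  rewrite -(fineK Wfin) -EFinM; apply: ge_ereal_sup => _ [th thD <-].
  rewrite lee_fin; apply: key => // phi lphi.
  rewrite -lee_fin fineK//.
  by have [] := W1_theta_marginal_ge PD PD' lphi.
move=> mu00' th thD; apply/eqP; rewrite -subr_eq0 -normr_le0.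
rewrite -(mulr0 C); apply: key => // phi lphi.
have [_ /(_ mu00') ->] := W1_theta_marginal_ge PD PD' lphi.
by rewrite subrr normr0.
Qed.
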